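(* Let $K$ be a field, $f:\mathbb Z_{\ge0}\to\mathbb R_{\ge0}$ an increasing function with $\sum_{\alpha\ge0}f(2^\alpha)/2^\alpha<+\infty$, and $B=\bigoplus_{n\ge0}B_n$ an integral graded $K$-algebra of finite type, generated by $B_1$. Suppose (i) the Krull dimension of $B$ is $>0$; (ii) each $B_n$ ($n\ge1$) carries a separated, exhaustive, left continuous $\mathbb R$-filtration making $B$ an $f$-pseudo-filtered graded $K$-algebra; (iii) $\limsup_{n\to\infty}\sup_{0\ne a\in B_n}\lambda(a)/n<+\infty$. Let $\nu_n=T_{1/n}\nu_{B_n}$. Then the supports of the $\nu_n$ ($n\ge1$) lie in a common bounded interval and $(\nu_n)_{n\ge1}$ converges vaguely to a Borel probability measure on $\mathbb R$.
   Context: Filtrations: decreasing families $(B_{n,s})_{s\in\mathbb R}$ of subspaces; separated: $\bigcap_sB_{n,s}=0$; exhaustive: $\bigcup_sB_{n,s}=B_n$; left continuous: $B_{n,s}=\bigcap_{t<s}B_{n,t}$; index $\lambda(a)=\sup\{s:a\in B_{n,s}\}$. $B$ is $f$-pseudo-filtered if $B_{n,s}B_{m,t}\subseteq B_{n+m,\,s+t-f(n)-f(m)}$ for all sufficiently large integers $n,m$ and all $s,t\in\mathbb R$. For nonzero finite-dimensional $W$, $\nu_W$ is the Borel probability measure with $\nu_W([r,+\infty[)=\dim\mathcal F_rW/\dim W$. $T_\varepsilon\nu$: image of $\nu$ under $x\mapsto\varepsilon x$. Vague convergence: convergence of integrals of continuous compactly supported functions. *)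

(* Defs.v *)
From HB Require Import structures.
From mathcomp Require Import all_boot all_order all_algebra.
From mathcomp Require Import all_classical all_reals all_analysis.
From mathcomp Require Import measurable_realfun.
Set Implicit Arguments. Unset Strict Implicit. Unset Printing Implicit Defensive.
Import Order.TTheory GRing.Theory Num.Theory.
Import numFieldNormedType.Exports.
Local Open Scope ring_scope.
Local Open Scope classical_set_scope.

Section LinAlg.
Context (K : fieldType) (A : lmodType K).

Definition is_subspace (W : A -> Prop) : Prop :=
  W 0 /\ forall (c : K) (u v : A), W u -> W v -> W (c *: u + v).

Definition lin_free (s : seq A) : Prop :=
  forall c : 'I_(size s) -> K,
    \sum_(i < size s) c i *: s`_i = 0 -> forall i, c i = 0.

Definition has_dim (W : A -> Prop) (d : nat) : Prop :=
  (exists s : seq A, size s = d /\ (forall x, x \in s -> W x) /\ lin_free s) /\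
  (forall s : seq A, (forall x, x \in s -> W x) -> lin_free s -> (size s <= d)%N).

End LinAlg.

Section Alg.
Context (K : fieldType) (A : comAlgType K).

Definition in_alg_gen (P : A -> Prop) (a : A) : Prop :=
  exists (k : nat) (c : 'I_k -> K) (t : 'I_k -> seq A),
    (forall i x, x \in t i -> P x) /\
    a = \sum_(i < k) c i *: \prod_(x <- t i) x.

Definition finite_type_alg : Prop :=
  exists s : seq A, forall a : A, in_alg_gen (fun x => x \in s) a.

Definition integral_alg : Prop :=
  (1 : A) != 0 /\ forall a b : A, a * b = 0 -> a = 0 \/ b = 0.

Definition prime_ideal (P : A -> Prop) : Prop :=
  [/\ P 0, (forall a b, P a -> P b -> P (a - b)),
      (forall r a, P a -> P (r * a)), ~ P 1 &
      (forall a b, P (a * b) -> P a \/ P b)].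

Definition krull_dim_pos : Prop :=
  exists P Q : A -> Prop, prime_ideal P /\ prime_ideal Q /\
    (forall x, P x -> Q x) /\ (exists x, Q x /\ ~ P x).

Definition graded_alg (B : nat -> A -> Prop) : Prop :=
  [/\ (forall n, is_subspace (B n)),
      B 0 1,
      (forall n m a b, B n a -> B m b -> B (n + m)%N (a * b)),
      (forall a : A, exists (N : nat) (c : 'I_N -> A),
          (forall i : 'I_N, B i (c i)) /\ a = \sum_(i < N) c i) &
      (forall (N : nat) (c : 'I_N -> A),
          (forall i : 'I_N, B i (c i)) -> \sum_(i < N) c i = 0 ->
          forall i, c i = 0)].

Definition generated_by (P : A -> Prop) : Prop :=
  forall a : A, in_alg_gen P a.

End Alg.

Section Filt.
Context (R : realType) (K : fieldType) (A : lmodType K).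

Definition good_filtration (W : A -> Prop) (F : R -> A -> Prop) : Prop :=
  [/\ (forall s, is_subspace (F s) /\ forall a, F s a -> W a),
      (forall s t a, s <= t -> F t a -> F s a),
      (forall a, (forall s, F s a) -> a = 0),
      (forall a, W a -> exists s, F s a) &
      (forall s a, (forall t, t < s -> F t a) -> F s a)].

Definition flambda (F : R -> A -> Prop) (a : A) : \bar R :=
  ereal_sup [set s%:E | s in [set s | F s a]].

End Filt.

Section Meas.
Context (R : realType).
Local Open Scope ereal_scope.

Definition is_filtration_measure (K : fieldType) (A : lmodType K)
  (W : A -> Prop) (F : R -> A -> Prop) (nu : {measure set R -> \bar R}) : Prop :=
  forall (r : R) (d dr : nat), has_dim W d -> has_dim (F r) dr ->
    nu `[r, +oo[ = (dr%:R / d%:R)%:E.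

Section Tscale.
Context (eps : R) (nu : {measure set R -> \bar R}).
Definition Tscale := pushforward nu (fun x : R => (x * eps)%R).

Let mf : measurable_fun [set: R] (fun x : R => (x * eps)%R).
Proof. exact: mulrr_measurable. Qed.

Let Tscale0 : Tscale set0 = 0.
Proof. by rewrite /Tscale /pushforward preimage_set0 measure0. Qed.

Let Tscale_ge0 B : 0 <= Tscale B.
Proof. exact: measure_ge0. Qed.

Let Tscale_sigma_additive : semi_sigma_additive Tscale.
Proof.
move=> F mF tF mUF; rewrite /Tscale /pushforward preimage_bigcup.
apply: measure_semi_sigma_additive.
- by move=> n; rewrite -[X in measurable X]setTI; exact: mf.
- apply/trivIsetP => /= i j _ _ ij; rewrite -preimage_setI.
  by move/trivIsetP : tF => /(_ _ _ _ _ ij) ->//; rewrite preimage_set0.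
- by rewrite -preimage_bigcup -[X in measurable X]setTI; exact: mf.
Qed.

HB.instance Definition _ := isMeasure.Build _ _ _
  Tscale Tscale0 Tscale_ge0 Tscale_sigma_additive.
End Tscale.

Definition msupport (nu : {measure set R -> \bar R}) : set R :=
  [set x : R | forall U : set R, open U -> U x -> 0 < nu U].

Definition vague_cvg (nus : nat -> {measure set R -> \bar R})
    (nu : {measure set R -> \bar R}) : Prop :=
  forall phi : R -> R, continuous phi ->
    compact (closure [set x | phi x != 0%R]) ->
    (fun n => \int[nus n]_x (phi x)%:E) @ \oo --> \int[nu]_x (phi x)%:E.

End Meas.

(* Main.v *)
(** The theorem follows from the inequality
      [dim (E^k X^(dk)) >= k^d dim E]
    for a finite dimensional subspace [E] of the domain [B], where [X] is spanned
    by algebraically independent elements [x_0, ..., x_d] of [B_1], with [d] such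
    that [dim B_n = O(n^d)]. To prove it, put [x_0 = 1], and for each [x_i] pass
    from [E] to the polynomials in [T] with coefficients in [E], filtered by the
    order of vanishing at the generic point [T = x_i]. The graded pieces (leaves)
    are modules over a polynomial ring with one more variable, their ranks add up
    to [dim E], and leading coefficients multiply without cancellation because
    [B] is a domain. Hence the leaf of order [k j + u] ([u < k]) of [E^k X^(dk)]
    contains the [k]-th power of the leaf of order [j] of [E].

    Applied to [E = F_p (p t)], with errors controlled by dyadic products and the
    summability of [f(2^a) / 2^a], the inequality yields
      [limsup_p dim F_p (p t) / p^d <= liminf_n dim F_n (n (t - e)) / n^d]
    for all [e > 0]. So the tails of the measures converge away from the jumps of
    a monotone function, which is the tail of the limit. *)

Require Import Defs.
From HB Require Import structures.
From mathcomp Require Import all_boot all_order all_algebra.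
From mathcomp Require Import all_classical all_reals all_analysis.
From mathcomp Require Import measurable_realfun.
From mathcomp Require Import zify ring lra.
Set Implicit Arguments. Unset Strict Implicit. Unset Printing Implicit Defensive.
Import Order.TTheory GRing.Theory Num.Theory.
Import numFieldNormedType.Exports.
Local Open Scope ring_scope.

(** * Linear independence over an integral domain *)

(** The growth bound and the power inequality must share the exponent [d]: with
    [n = k p + (d k + q)] and [q] bounded, the factor [k^d] is close to [(n/p)^d], so normalized
    dimensions are comparable and bounded. The [d k + q] degrees taken up by [X] obey only the crude
    bound that [F_m (-c m)] is all of [B_m]. They form a fraction of about [d/p] of [n], hence [p]
    must be large first, and [n] large depending on [p]. For very negative [t] the comparison shows
    that [dim B_n / n^d] converges to a positive limit, which allows dividing by [dim B_n]. Passing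
    to leaves replaces the ring of scalars by a polynomial ring over it, never a field; so
    independence is treated over domains, where a maximal independent family generates only up to
    nonzero multiples. *)

Section LinearIndependence.
Context (k R : idomainType) (iota : {rmorphism k -> R}).

Fixpoint in_span (s : seq R) (y : R) : Prop :=
  if s is x :: s' then exists c, in_span s' (y - iota c * x) else y = 0.

(** Scalars cannot be inverted, so no nonzero multiple of the head may lie in the span of the tail;
    asking this of the head alone would be too weak. *)
Fixpoint indep (s : seq R) : Prop :=
  if s is x :: s' then (forall c, in_span s' (iota c * x) -> c = 0) /\ indep s'
  else True.

Definition submod (W : R -> Prop) : Prop :=
  [/\ W 0, (forall a b, W a -> W b -> W (a + b)) &
      (forall c a, W a -> W (iota c * a))].

Definition has_indep (W : R -> Prop) (m : nat) : Prop :=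
  exists s, [/\ size s = m, (forall x, x \in s -> W x) & indep s].

Lemma in_span_submod s : submod (in_span s).
Proof.
elim: s => [|x s [s0 sD sZ]] /=.
  by split=> [//|a b -> ->|c a ->]; rewrite ?addr0 ?mulr0.
split.
- by exists 0; rewrite rmorph0 mul0r subr0.
- move=> a b [c ca] [c' cb]; exists (c + c').
  by rewrite rmorphD mulrDl opprD addrACA; exact: sD.
- move=> c a [c' ca]; exists (c * c').
  by rewrite rmorphM -mulrA -mulrBr; exact: sZ.
Qed.

Lemma submodN W a : submod W -> W a -> W (- a).
Proof. by case=> _ _ WZ Wa; rewrite -mulN1r -(rmorph1 iota) -rmorphN; exact: WZ. Qed.

Lemma submodB W a b : submod W -> W a -> W b -> W (a - b).
Proof. by move=> sW Wa Wb; case: (sW) => _ WD _; apply: WD (submodN sW Wb). Qed.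

Lemma submod_sum W (I : Type) (r : seq I) (P : pred I) (F : I -> R) :
  submod W -> (forall i, P i -> W (F i)) -> W (\sum_(i <- r | P i) F i).
Proof. by case=> W0 WD _ WF; apply: big_ind. Qed.

Lemma in_span_min W s y : submod W -> (forall x, x \in s -> W x) ->
  in_span s y -> W y.
Proof.
move=> sW; case: (sW) => W0 WD WZ; elim: s y => [|x s IH] y Ws /=; first by move->.
case=> c /IH h; rewrite -[y](subrK (iota c * x)); apply: WD.
  by apply: h => z zs; apply: Ws; rewrite inE zs orbT.
by apply: WZ; apply: Ws; rewrite mem_head.
Qed.

Lemma in_span_cons s x y : in_span s y -> in_span (x :: s) y.
Proof. by exists 0; rewrite rmorph0 mul0r subr0. Qed.

Lemma mem_in_span s x : x \in s -> in_span s x.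
Proof.
elim: s => [//|z s IH]; rewrite inE => /predU1P[->|/IH]; last exact: in_span_cons.
by exists 1; rewrite rmorph1 mul1r subrr; case: (in_span_submod s).
Qed.

Lemma in_spanP s y : in_span s y <->
  exists c : 'I_(size s) -> k, y = \sum_i iota (c i) * s`_i.
Proof.
elim: s y => [|x s IH] y.
  split=> [->|[c ->]]; last by rewrite /= big_ord0.
  by exists (fun=> 0); rewrite big_ord0.
split=> [[c /IH[c' E]]|[c ->]].
  exists (fun i => if unlift ord0 i is Some j then c' j else c).
  rewrite big_ord_recl unlift_none /=.
  under eq_bigr do rewrite liftK.
  by rewrite -E addrC subrK.
exists (c ord0); apply/IH; exists (c \o lift ord0).
by rewrite big_ord_recl /= [LHS]addrC addKr.
Qed.

Lemma indepP s : indep s <->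
  forall c : 'I_(size s) -> k, \sum_i iota (c i) * s`_i = 0 -> forall i, c i = 0.
Proof.
elim: s => [|x s IH]; first by split=> // _ c _ [].
split=> [[hx /IH hs] c|h].
  rewrite big_ord_recl /= => E.
  have c0 : c ord0 = 0.
    apply: hx; apply/in_spanP; exists (fun i => - c (lift ord0 i)).
    rewrite (eq_bigr (fun i => - (iota (c (lift ord0 i)) * s`_i))).
      by rewrite sumrN; apply/eqP; rewrite -addr_eq0 E.
    by move=> i _; rewrite rmorphN mulNr.
  move: E; rewrite c0 rmorph0 mul0r add0r => /(hs (c \o lift ord0)) E i.
  by case: (unliftP ord0 i) => [j|] -> //; exact: E.
split.
  move=> c /in_spanP[c' E].
  have := h (fun i => if unlift ord0 i is Some j then - c' j else c).
  rewrite big_ord_recl unlift_none /=.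
  under eq_bigr do rewrite liftK rmorphN mulNr.
  by rewrite sumrN -E subrr => /(_ erefl ord0); rewrite unlift_none.
apply/IH => c E i.
have := h (fun i => if unlift ord0 i is Some j then c j else 0).
rewrite big_ord_recl unlift_none /= rmorph0 mul0r add0r.
under eq_bigr do rewrite liftK.
by move=> /(_ E (lift ord0 i)); rewrite liftK.
Qed.

(** Steinitz bound up to denominators: if [t] is shorter, the coefficient matrix padded by zero
    columns is singular, and a row in its kernel, rescaled by the denominators, is a relation in
    [s]. *)
Lemma indep_size_le s t : indep s ->
  (forall x, x \in s -> exists2 c, c != 0 & in_span t (iota c * x)) ->
  (size s <= size t)%N.
Proof.
move=> /indepP fs st; rewrite leqNgt; apply/negP => lt.
have /(_ _)/cid-/all_sig[c hc] (i : 'I_(size s)) :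
    exists c : k * ('I_(size t) -> k), c.1 != 0 /\
      iota c.1 * s`_i = \sum_j iota (c.2 j) * t`_j.
  have [//|c c0 /in_spanP[c' E]] := st s`_i; first exact: mem_nth.
  by exists (c, c').
pose A : 'M[k]_(size s) := \matrix_(i, j)
  if insub (val j) is Some j' then (c i).2 j' else 0.
have : \det A == 0.
  rewrite -det_tr; apply/det0P; exists (delta_mx 0 (Ordinal lt)).
    apply/eqP => /matrixP /(_ 0 (Ordinal lt)); rewrite !mxE !eqxx.
    by apply/eqP; exact: oner_neq0.
  rewrite -rowE; apply/matrixP => i j; rewrite !mxE insubF //.
  by rewrite /= ltnn.
case/det0P => v v0 vA; case/eqP: v0; apply/matrixP => a j; rewrite ord1 !mxE.
have E : \sum_i iota (v 0 i * (c i).1) * s`_i = 0.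
  under eq_bigr => i _.
    rewrite rmorphM -mulrA (hc i).2 mulr_sumr.
    under eq_bigr do rewrite mulrA -rmorphM.
    over.
  rewrite exchange_big big1 //= => j' _.
  rewrite -mulr_suml -rmorph_sum.
  have := congr1 (fun M : 'rV_(size s) => M 0 (widen_ord (ltnW lt) j')) vA.
  rewrite !mxE; under eq_bigr => i _.
    rewrite mxE /=. rewrite (insubT (fun x => x < size t)%N (ltn_ord j')) /=.
    rewrite (_ : Sub _ _ = j'); last exact/val_inj. over.
  by move=> ->; rewrite rmorph0 mul0r.
by have /eqP := fs _ E j; rewrite mulf_eq0 (negPf (hc j).1) orbF => /eqP.
Qed.

Lemma indep_neq0 x s : indep (x :: s) -> x != 0.
Proof.
case=> h _; apply/eqP => x0; have /eqP := oner_neq0 k; apply.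
by apply: h; rewrite x0 mulr0; case: (in_span_submod s).
Qed.

Lemma indep_mul a s : a != 0 -> indep s -> indep [seq a * x | x <- s].
Proof.
move=> a0.
have sp t y : in_span [seq a * x | x <- t] (a * y) -> in_span t y.
  elim: t y => [|x t IH] y /=.
    by move/eqP; rewrite mulf_eq0 (negPf a0) => /eqP.
  by case=> c h; exists c; apply: IH; rewrite mulrBr [a * (_ * _)]mulrCA.
elim: s => [//|x s IH] /= [h /IH hs]; split=> // c.
by rewrite mulrCA => /sp /h.
Qed.

(** Stands in for a basis over the fraction field of the scalars. *)
Lemma max_indep W m : ~ has_indep W m ->
  exists t, [/\ (size t < m)%N, (forall x, x \in t -> W x), indep t &
    forall w, W w -> exists2 c, c != 0 & in_span t (iota c * w)].
Proof.
elim: m => [|m IH] nh; first by case: nh; exists [::].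
have [[t [sz Wt ft]]|/IH[t [sz Wt ft h]]] := pselect (has_indep W m); last first.
  by exists t; split=> //; rewrite ltnW.
exists t; split=> //; first by rewrite sz.
move=> w Ww; apply: contrapT => no; apply: nh; exists (w :: t); split.
- by rewrite /= sz.
- by move=> x; rewrite inE => /predU1P[->//|/Wt].
- split=> // c h; apply/eqP; apply: contrapT => /negP c0.
  by apply: no; exists c.
Qed.

End LinearIndependence.

(** * Leaves at a generic point *)

Section Evaluation.
Context (k R : idomainType) (iota : {rmorphism k -> R}) (x : R).

Let comm_iota : commr_rmorph iota x.
Proof. by move=> y; exact: mulrC. Qed.

(** Makes [R] an algebra over [k[T]] with [T] acting as [x]; each variable of the induction changes
    the scalars in this way. *)
Definition evm : {rmorphism {poly k} -> R} := horner_morph comm_iota.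

Lemma evmE p : evm p = (map_poly iota p).[x].
Proof. by []. Qed.

Lemma evmC c : evm c%:P = iota c.
Proof. exact: horner_morphC. Qed.

Lemma evmX : evm 'X = x.
Proof. exact: horner_morphX. Qed.

End Evaluation.

Section Leaves.
Context (k R : idomainType) (iota : {rmorphism k -> R}) (x : R).

Local Notation Y := ('X - x%:P).
Local Notation iotaT := (map_poly iota).
Local Notation iotax := (evm iota x).

Definition poly_in (W : R -> Prop) (p : {poly R}) : Prop := forall i, W p`_i.

(* [leaf W j] consists of the leading coefficients at [T = x] of the
   polynomials in [W[T]] vanishing there to order at least [j]. *)
Definition leaf (W : R -> Prop) (j : nat) (a : R) : Prop :=
  exists2 r, poly_in W (r * Y ^+ j) & r.[x] = a.

Lemma submod_poly_in W : submod iota W -> submod iotaT (poly_in W).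
Proof.
move=> sW; case: (sW) => W0 WD WZ; split.
- by move=> i; rewrite coef0.
- by move=> p q Wp Wq i; rewrite coefD; exact: WD.
- move=> c p Wp i; rewrite coefM; apply: (submod_sum _ sW) => j _.
  by rewrite coef_map; exact: WZ.
Qed.

Lemma submod_leaf W j : submod iota W -> submod iotax (leaf W j).
Proof.
move=> /submod_poly_in[W0 WD WZ]; split.
- by exists 0; rewrite ?horner0 ?mul0r.
- move=> a b [r Wr <-] [r' Wr' <-]; exists (r + r'); last by rewrite hornerD.
  by rewrite mulrDl; exact: WD.
- move=> c a [r Wr <-]; exists (iotaT c * r); last by rewrite hornerM.
  by rewrite -mulrA; exact: WZ.
Qed.

(** Extending scalars to [k[T]] does not raise the rank: a maximal independent family of [W], seen
    as constants, generates [W[T]] up to denominators. *)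
Lemma poly_in_indep W m : submod iota W -> has_indep iotaT (poly_in W) m ->
  has_indep iota W m.
Proof.
move=> sW [qs [szq Wq fq]]; apply: contrapT => /max_indep[t [szt Wt ft ht]].
suff : (size qs <= size (map polyC t))%N by rewrite szq size_map leqNgt szt.
apply: (indep_size_le fq) => q qqs.
have spC w : in_span iota t w -> in_span iotaT (map polyC t) w%:P.
  elim: (t) w => [|y s IH] w /=; first by move=> ->.
  by case=> c h; exists c%:P; rewrite map_polyC -polyCM -polyCB; exact: IH.
have [sp0 spD spZ] := in_span_submod iotaT (map polyC t).
have Wq' : poly_in W q by exact: Wq.
rewrite -[q]coefK poly_def; elim: (size q) => [|n [c c0 hc]].
  by exists 1; rewrite ?oner_neq0 // big_ord0 mulr0.
have [d d0 hd] := ht _ (Wq' n).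
exists (c * d%:P); first by rewrite mulf_neq0 // polyC_eq0.
rewrite big_ord_recr /= mulrDr; apply: spD.
  by rewrite mulrC rmorphM /= mulrA mulrC; apply: spZ; rewrite mulrC.
rewrite rmorphM -mulrA; apply: (spZ _ _); rewrite /= map_polyC /= -mul_polyC mulrA -polyCM mulrC.
by rewrite -(map_polyXn iota); apply: spZ; exact: spC.
Qed.

(** Lifts of independent leading coefficients of different orders are independent together: dividing
    a relation by its lowest power of [Y] and evaluating at [x] gives a relation inside a single
    leaf. *)
Lemma leaves_glue W (m : nat -> nat) n : submod iota W ->
  (forall j, (j < n)%N -> has_indep iotax (leaf W j) (m j)) ->
  has_indep iota W (\sum_(j < n) m j).
Proof.
move=> sW hl; apply: poly_in_indep => //.
have [sp0 spD spZ] := submod_poly_in sW.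
(* Orders are added downwards from [n - 1], so that everything already present is divisible by a
   higher power of [Y]. *)
suff /(_ n (leqnn n)) [qs [sq Wq fq _]] : forall i, (i <= n)%N ->
    exists qs, [/\ size qs = (\sum_(n - i <= j < n) m j)%N,
    (forall q, q \in qs -> poly_in W q), indep iotaT qs &
    (forall q, q \in qs -> exists r, q = r * Y ^+ (n - i))].
  by exists qs; split=> //; rewrite sq subnn big_mkord.
elim=> [|i IH] lein; first by exists [::]; rewrite subn0 big_geq.
have [qs [sq Wq fq dq]] := IH (ltnW lein).
have lt : (n - i.+1 < n)%N by lia.
have [ts [st Wt ft]] := hl _ lt.
have {}IH : exists ps, [/\ map (fun r => r.[x]) ps = ts &
    forall r, r \in ps -> poly_in W (r * Y ^+ (n - i.+1))].
  elim: (ts) Wt => [|t ts' IHt] Wt; first by exists [::].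
  have [|ps [<- Wps]] := IHt; first by move=> a ha; apply: Wt; rewrite inE ha orbT.
  have [r Wr <-] := Wt t (mem_head _ _).
  by exists (r :: ps); split=> // r'; rewrite inE => /predU1P[->//|/Wps].
have [ps [E Wps]] := IH.
exists ([seq r * Y ^+ (n - i.+1) | r <- ps] ++ qs).
have e : (n - i = (n - i.+1).+1)%N by lia.
split.
- rewrite size_cat size_map sq -(size_map (fun r : {poly R} => r.[x])) E st.
  by rewrite [RHS]big_ltn // e.
- by move=> q; rewrite mem_cat => /orP[/mapP[r rps ->]|/Wq //]; exact: Wps.
- move: ft; rewrite -E; elim: (ps) => [_ //|r rs IHr] /= [hr /IHr hrs].
  split=> // c; set j := (n - i.+1)%N in e *.
  have lead q : in_span iotaT ([seq r * Y ^+ j | r <- rs] ++ qs) (q * Y ^+ j) ->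
      in_span iotax [seq r.[x] | r <- rs] q.[x].
    elim: (rs) q => [|r' rs' IHrs] q /=.
      move=> h.
      suff : exists s, q * Y ^+ j = s * Y ^+ j.+1.
        case=> s; rewrite exprS mulrA => /mulIf -> //.
          by rewrite hornerM hornerXsubC subrr mulr0.
        by rewrite expf_neq0 // polyXsubC_eq0.
      apply: (in_span_min (W := fun q => exists s, q = s * Y ^+ j.+1) _ _ h).
        split; first by exists 0; rewrite mul0r.
          by move=> a b [s ->] [s' ->]; exists (s + s'); rewrite mulrDl.
        by move=> c' a [s ->]; exists (iotaT c' * s); rewrite mulrA.
      by move=> q' /dq; rewrite e.
    case=> c' h; exists c'; rewrite evmE -hornerM -[- _]hornerN -hornerD.
    by apply: IHrs; rewrite mulrBl -mulrA.
  by rewrite mulrA => /lead; rewrite hornerM; exact: hr.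
- move=> q; rewrite mem_cat => /orP[/mapP[r rps ->]|/dq[r ->]]; first by exists r.
  by exists (r * Y); rewrite e exprS mulrA.
Qed.

Lemma in_span_lift (ps : seq {poly R}) z :
  in_span iotax [seq p.[x] | p <- ps] z ->
  exists2 g, in_span iotaT ps g & g.[x] = z.
Proof.
elim: ps z => [|p ps IH] z /=; first by move->; exists 0; rewrite ?horner0.
case=> c /IH[g sg Eg]; exists (g + iotaT c * p).
  by exists c; rewrite addrK.
by rewrite hornerD hornerM Eg -evmE subrK.
Qed.

Hypothesis x_transc : injective iotax.

(* Reduce the new vector [y] against the previous leading coefficients: each
   failed attempt raises the order of vanishing, and there are only finitely
   many orders at which a reduction can be needed. *)
Lemma echelon s : indep iota s -> exists dec : seq (nat * {poly R}),
  [/\ size dec = size s,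
      (forall a, a \in dec -> poly_in (in_span iota s) (a.2 * Y ^+ a.1)) &
      forall j, indep iotax [seq p.[x] | p <- [seq a.2 | a <- dec & a.1 == j]]].
Proof.
elim: s => [_|y s IH [hy fs]]; first by exists [::].
have [dec [sd Ps fd]] := IH fs.
have sS := submod_poly_in (in_span_submod iota s).
have sS' := submod_poly_in (in_span_submod iota (y :: s)).
(* [H j r]: modulo polynomials over the span of [s], [r * Y ^+ j] is a nonzero multiple of [y]. *)
pose H j r := exists2 c : {poly k}, c != 0 &
  poly_in (in_span iota s) (r * Y ^+ j - iotaT c * y%:P).
have sub p : poly_in (in_span iota s) p -> poly_in (in_span iota (y :: s)) p.
  by move=> h i; apply: in_span_cons; exact: h.
have Hin j r : H j r -> poly_in (in_span iota (y :: s)) (r * Y ^+ j).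
  case=> c c0 /sub h; rewrite -[_ * _](subrK (iotaT c * y%:P)).
  case: (sS') => _ SD SZ; apply: SD h _; apply: SZ => i.
  rewrite coefC; case: eqP => _; last by case: (in_span_submod iota (y :: s)).
  by apply: mem_in_span; rewrite mem_head.
have Hn0 j r : H j r -> r != 0.
  case=> c c0 h; apply: contraNneq c0 => r0; apply/eqP/polyP => i; rewrite coef0.
  apply: hy; have := h i; rewrite r0 mul0r sub0r coefN coefMC coef_map.
  by move/(submodN (in_span_submod iota s)); rewrite opprK.
suff [j [r [Hjr fr]]] : exists j r, H j r /\ indep iotax
    (r.[x] :: [seq p.[x] | p <- [seq a.2 | a <- dec & a.1 == j]]).
  exists ((j, r) :: dec); split=> [|a|j'].
  - by rewrite /= sd.
  - by rewrite inE => /predU1P[->|/Ps/sub //]; exact: Hin.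
  - by rewrite /=; case: eqP => [<-|_]; [exact: fr|exact: fd].
pose n := (\max_(a <- dec) a.1).+1.
have big j : (n <= j)%N -> [seq a <- dec | a.1 == j] = [::].
  move=> nj; apply/eqP; rewrite -(negbK (_ == _)) -has_filter.
  apply/hasP => -[a ad /eqP aj]; move: nj; rewrite -aj ltnNge.
  by rewrite (leq_bigmax_seq (F := fun a : nat * {poly R} => a.1) a).
suff : forall e j r, (n - j <= e)%N -> H j r -> exists j r, H j r /\ indep iotax
    (r.[x] :: [seq p.[x] | p <- [seq a.2 | a <- dec & a.1 == j]]).
  move/(_ n 0%N y%:P (leq_subr _ _)); apply; exists 1; rewrite ?oner_neq0 //.
  by rewrite rmorph1 expr0 mulr1 mul1r subrr; case: sS.
elim=> [|e IHe] j r.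
  rewrite leqn0 subn_eq0 => nj Hjr.
  (* Dividing out the exact multiplicity of the root [x] leaves a nonzero leading coefficient; alone
     in its order, it is independent because [x] is transcendental. *)
  have [m [r' /implyP/(_ (Hn0 _ _ Hjr)) r'x E]] := multiplicity_XsubC r x.
  exists (j + m)%N, r'; split.
    by case: Hjr => c c0 h; exists c => //; rewrite addnC exprD mulrA -E.
  rewrite big /=; last by lia.
  split=> // c /eqP; rewrite mulf_eq0 => /orP[/eqP c0|r0]; last by move: r'x; rewrite rootE r0.
  by apply: x_transc; rewrite rmorph0; exact: c0.
move=> le Hjr.
have [f|nf] := pselect (indep iotax
    (r.[x] :: [seq p.[x] | p <- [seq a.2 | a <- dec & a.1 == j]])).
  by exists j, r.
have [c1 c10 /in_span_lift[g sg Eg]] : exists2 c, c != 0 & in_span iotax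
    [seq p.[x] | p <- [seq a.2 | a <- dec & a.1 == j]] (iotax c * r.[x]).
  apply: contrapT => no; apply: nf; split=> // c h; apply/eqP.
  by apply: contrapT => /negP c0; apply: no; exists c.
(* The leading terms cancel at [x], so one more factor [Y] splits off and the order rises. *)
have /factor_theorem[r3 E3] : root (iotaT c1 * r - g) x.
  by rewrite rootE hornerD hornerM hornerN Eg subrr.
apply: (IHe j.+1 r3); first by lia.
case: Hjr => c c0 h; exists (c1 * c); first exact: mulf_neq0.
have -> : r3 * Y ^+ j.+1 - iotaT (c1 * c) * y%:P =
    iotaT c1 * (r * Y ^+ j - iotaT c * y%:P) - g * Y ^+ j.
  by rewrite exprS mulrA -E3 rmorphM /= !mulrBl mulrBr !mulrA addrAC.
apply: (submodB sS); first by case: sS => _ _; apply.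
apply: (in_span_min (W := fun g => poly_in (in_span iota s) (g * Y ^+ j)) _ _ sg).
  case: sS => S0 SD SZ; split; first by rewrite mul0r.
    by move=> a b ha hb; rewrite mulrDl; exact: SD.
  by move=> c' a ha; rewrite -mulrA; exact: SZ.
by move=> p /mapP[a]; rewrite mem_filter => /andP[/eqP <- /Ps ha ->].
Qed.

(** Converse of [leaves_glue]: an echelon family is sorted by order of vanishing, and [mm j] counts
    its members of order [j]. *)
Lemma leaves_split V m : submod iota V -> has_indep iota V m ->
  exists n (mm : nat -> nat), (\sum_(j < n) mm j)%N = m /\
    forall j, has_indep iotax (leaf V j) (mm j).
Proof.
move=> sV [s [<- Vs fs]]; have [dec [<- Ps fd]] := echelon fs.
exists (\max_(a <- dec) a.1).+1, (fun j => count (fun a => a.1 == j) dec); split.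
  have : all (fun a => a.1 < (\max_(a <- dec) a.1).+1)%N dec.
    by apply/allP => a ad; rewrite ltnS (leq_bigmax_seq (F := fun a : nat * {poly R} => a.1) a).
  move: (\max_(a <- dec) a.1).+1 => n; elim: (dec) => [_|a d IH] /=.
    by rewrite big1.
  case/andP => an /IH; rewrite big_split /= => ->.
  rewrite (bigD1 (Ordinal an)) //= eqxx big1 // => i /negPf h.
  by move: h; rewrite -val_eqE /= eq_sym => ->.
move=> j; exists [seq p.[x] | p <- [seq a.2 | a <- dec & a.1 == j]]; split=> //.
  by rewrite !size_map size_filter.
move=> z /mapP[p /mapP[a]]; rewrite mem_filter => /andP[/eqP <- ad ->] ->.
exists a.2 => // i; apply: (in_span_min sV Vs); exact: Ps.
Qed.

End Leaves.

(** * Power inequality for products of subspaces *)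

Section Superadditivity.
Context (R : idomainType).

(* Algebraic independence: the iterated evaluation [k[X1][X2]... -> R] is
   injective. *)
Fixpoint alg_indep (xs : seq R) : forall k : idomainType, {rmorphism k -> R} -> Prop :=
  if xs is x :: xs' then fun k iota => alg_indep xs' (evm iota x)
  else fun k iota => injective iota.

(** Each exponent is bounded separately, because each variable contributes one power from an
    expansion of [(T - x)^u] with [u < N]. *)
Fixpoint monom_lt (N : nat) (xs : seq R) (a : R) : Prop :=
  if xs is x :: xs' then
    exists b a', [/\ (b < N)%N, monom_lt N xs' a' & a = x ^+ b * a']
  else a = 1.

Lemma alg_indep_inj xs (k : idomainType) (iota : {rmorphism k -> R}) :
  alg_indep xs iota -> injective iota.
Proof.
elim: xs k iota => [//|x xs IH] k iota /= /IH h a b E.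
by apply: polyC_inj; apply: h; rewrite !evmC.
Qed.

Lemma poly_in_prod (V W : R -> Prop) (k : idomainType) (iota : {rmorphism k -> R})
    (ps : seq {poly R}) (q : {poly R}) : submod iota W ->
  (forall p, p \in ps -> poly_in V p) ->
  (forall es, size es = size ps -> (forall e, e \in es -> V e) ->
     forall i, W ((\prod_(e <- es) e) * q`_i)) ->
  poly_in W ((\prod_(p <- ps) p) * q).
Proof.
move=> sW; elim: ps q => [|p ps IH] q Vps hq.
  by move=> i; rewrite big_nil mul1r; have := hq [::] erefl _ i;
    rewrite big_nil mul1r; apply.
rewrite big_cons [p * _]mulrC -mulrA; apply: IH.
  by move=> p' h; apply: Vps; rewrite inE h orbT.
move=> es ses Ves i; rewrite coefM mulr_sumr; apply: (submod_sum _ sW) => j _.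
have := hq (p`_j :: es); rewrite /= ses big_cons => /(_ erefl _ (i - j)%N).
rewrite [p`_j * _]mulrC mulrA; apply => e; rewrite inE => /predU1P[->|/Ves //].
by apply: Vps; rewrite mem_head.
Qed.

(** Using the induction hypothesis also for the submodule of those [a] with [x * a] in [W] avoids
    the binomial formula. *)
Lemma poly_in_XsubC_exp (W : R -> Prop) (k : idomainType)
    (iota : {rmorphism k -> R}) (x : R) (u : nat) : submod iota W ->
  (forall b, (b <= u)%N -> W (x ^+ b)) -> poly_in W (('X - x%:P) ^+ u).
Proof.
elim: u W => [|u IH] W sW hW i.
  rewrite expr0 coef1; case: eqP => _; last by case: sW.
  by have := hW 0%N isT; rewrite expr0.
rewrite exprS mulrBl coefB coefXM mul_polyC coefZ; apply: (submodB sW).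
  case: eqP => _; first by case: sW.
  by apply: IH => // b bu; apply: hW; exact: leqW.
apply: (IH (fun a => W (x * a))).
  case: sW => W0 WD WZ; split; first by rewrite mulr0.
    by move=> a b ha hb; rewrite mulrDr; exact: WD.
  by move=> c a ha; rewrite mulrCA; exact: WZ.
by move=> b bu; rewrite -exprS; exact: hW.
Qed.

(* For every [u < N], the leaf of order [N j + u] of [W] contains the [N]-th
   power of the leaf of order [j] of [V]. *)
Theorem indep_power_mul xs (k : idomainType) (iota : {rmorphism k -> R}) N m
    (V W : R -> Prop) : (0 < N)%N -> alg_indep xs iota ->
  submod iota V -> submod iota W -> has_indep iota V m ->
  (forall es a, size es = N -> (forall e, e \in es -> V e) -> monom_lt N xs a ->
     W ((\prod_(e <- es) e) * a)) ->
  has_indep iota W (N ^ size xs * m).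
Proof.
move=> N0; elim: xs k iota m V W => [|x xs IH] k iota m V W ai sV sW hV hVW.
  rewrite expn0 mul1n; case: hV => -[|y s] [<- Vs fs]; first by exists [::].
  (* With no variable left, multiplication by a fixed nonzero power carries the family from [V] to
     [W]. *)
  exists [seq y ^+ N.-1 * z | z <- y :: s]; split.
  - by rewrite size_map.
  - move=> z /mapP[z' hz' ->].
    have := hVW (z' :: nseq N.-1 y) 1; rewrite /= size_nseq prednK // mulr1.
    rewrite big_cons big_nseq iter_mulr_1 mulrC; apply=> // e.
    rewrite inE mem_nseq => /orP[/eqP ->|/andP[_ /eqP ->]]; apply: Vs => //.
    exact: mem_head.
  - by apply: indep_mul => //; rewrite expf_neq0 // (indep_neq0 fs).
have [n [mm [<- hmm]]] := leaves_split (alg_indep_inj (ai : alg_indep xs (evm iota x))) sV hV.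
(* Each order [j] of [V] serves the [N] orders [w] with [w %/ N = j]. *)
have -> : (N ^ size (x :: xs) * (\sum_(j < n) mm j) =
    \sum_(w < n * N) N ^ size xs * mm (w %/ N))%N.
  elim: n => [|n IHn]; first by rewrite mul0n !big_ord0 muln0.
  rewrite big_ord_recr /= mulnDr IHn -!(big_mkord xpredT
    (fun w => N ^ size xs * mm (w %/ N))%N).
  rewrite mulSn addnC (big_cat_nat (leq0n _) (leq_addl N (n * N))) /=.
  rewrite [in RHS]addnC; congr addn.
  rewrite -{1}[(n * N)%N]add0n big_addn addnK big_mkord.
  rewrite (eq_bigr (fun=> N ^ size xs * mm n)%N) => [|i _].
    by rewrite sum_nat_const card_ord expnS mulnA.
  by rewrite addnC divnMDl // divn_small ?addn0.
apply: (@leaves_glue _ _ iota x W (fun w => N ^ size xs * mm (w %/ N))%N _ sW) => w wn.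
apply: (IH _ _ _ (leaf x V (w %/ N)) (leaf x W w) ai) => //.
- exact: submod_leaf.
- exact: submod_leaf.
move=> es a ses Ves ma.
have [rs [Er Vr]] : exists rs, map (fun r => r.[x]) rs = es /\
    forall r, r \in rs -> poly_in V (r * ('X - x%:P) ^+ (w %/ N)).
  elim: (es) Ves => [|e es' IHe] Ves; first by exists [::].
  have [|rs [<- Vrs]] := IHe; first by move=> z hz; apply: Ves; rewrite inE hz orbT.
  have [r Vr <-] := Ves e (mem_head _ _).
  by exists (r :: rs); split=> // r'; rewrite inE => /predU1P[->//|/Vrs].
exists ((\prod_(r <- rs) r) * a%:P); last first.
  by rewrite hornerM hornerC -Er big_map horner_prod.
(* Of the [w] factors ['X - x%:P], each of the [N] polynomials takes [w %/ N]; the [w %% N] left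
   over produce the power of the new variable. *)
have -> : \prod_(r <- rs) r * a%:P * ('X - x%:P) ^+ w =
    (\prod_(p <- [seq r * ('X - x%:P) ^+ (w %/ N) | r <- rs]) p) *
      (a%:P * ('X - x%:P) ^+ (w %% N)).
  rewrite big_map big_split /= prodrXr big_const_seq count_predT iter_addn_0.
  rewrite -(size_map (fun r : {poly R} => r.[x])) Er ses.
  by rewrite {1}(divn_eq w N) exprD; ring.
apply: (poly_in_prod (V := V) sW).
  by move=> p /mapP[r hr ->]; exact: Vr.
move=> es'; rewrite size_map -(size_map (fun r : {poly R} => r.[x])) Er ses.
move=> ses' Ves' i; rewrite mul_polyC coefZ.
apply: (poly_in_XsubC_exp (iota := iota) (W := fun b => W (\prod_(e <- es') e * (a * b)))).
  case: sW => W0 WD WZ; split; first by rewrite !mulr0.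
    by move=> b c hb hc; rewrite !mulrDr; exact: WD.
  move=> c b hb; rewrite (_ : _ * (_ * _) = iota c * (\prod_(e <- es') e * (a * b))); last by ring.
  exact: WZ.
move=> b bw; apply: hVW => //; exists b, a; split=> //; last exact: mulrC.
by apply: leq_ltn_trans bw _; rewrite ltn_mod.
Qed.

End Superadditivity.

(** * Growth of finitely generated algebras *)

Section Growth.
Context (R : idomainType).

(** Polynomial expressions of total degree at most [n]; the inductive form gives estimates by
    induction, without multivariate polynomials. *)
Inductive poly_le (k : idomainType) (iota : {rmorphism k -> R}) (zs : seq R) :
    nat -> R -> Prop :=
| poly_le_const n c : poly_le iota zs n (iota c)
| poly_le_add n a b : poly_le iota zs n a -> poly_le iota zs n b ->
    poly_le iota zs n (a + b)
| poly_le_gen n z a : z \in zs -> poly_le iota zs n a ->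
    poly_le iota zs n.+1 (z * a).

Lemma poly_le_mono (k : idomainType) (iota : {rmorphism k -> R}) zs zs' n m a :
  {subset zs <= zs'} -> (n <= m)%N -> poly_le iota zs n a -> poly_le iota zs' m a.
Proof.
move=> sub le h; elim: h m le => {n a} [n c|n a b _ IHa _ IHb|n z a zz _ IH] m le.
- exact: poly_le_const.
- by apply: poly_le_add; [exact: IHa|exact: IHb].
- by case: m le => // m le; apply: poly_le_gen; [exact: sub|exact: IH].
Qed.

Lemma poly_le_scale (k : idomainType) (iota : {rmorphism k -> R}) zs n c a :
  poly_le iota zs n a -> poly_le iota zs n (iota c * a).
Proof.
elim=> {n a} [n d|n a b _ IHa _ IHb|n z a zz _ IH].
- by rewrite -rmorphM; exact: poly_le_const.
- by rewrite mulrDr; exact: poly_le_add.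
- by rewrite mulrCA; exact: poly_le_gen.
Qed.

Lemma poly_le_mul (k : idomainType) (iota : {rmorphism k -> R}) zs n m a b :
  poly_le iota zs n a -> poly_le iota zs m b -> poly_le iota zs (n + m) (a * b).
Proof.
move=> ha hb; elim: ha => {n a} [n d|n a b' _ IHa _ IHb|n z a zz _ IH].
- by apply: poly_le_scale; apply: poly_le_mono hb => //; exact: leq_addl.
- by rewrite mulrDl; exact: poly_le_add.
- by rewrite -mulrA addSn; exact: poly_le_gen.
Qed.

Lemma poly_le_exp (k : idomainType) (iota : {rmorphism k -> R}) zs h m b :
  poly_le iota zs h b -> poly_le iota zs (m * h) (b ^+ m).
Proof.
move=> hb; elim: m => [|m IH]; last by rewrite exprS mulSn; exact: poly_le_mul.
by rewrite expr0 -(rmorph1 iota); exact: poly_le_const.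
Qed.

(** Scalars in [k[T]] become polynomials in [x], which costs an uncontrolled degree; only its
    finiteness matters below. *)
Lemma poly_le_evm (k : idomainType) (iota : {rmorphism k -> R}) x xs h b :
  poly_le (evm iota x) xs h b -> exists h', poly_le iota (x :: xs) h' b.
Proof.
have sub : {subset xs <= x :: xs} by move=> z hz; rewrite inE hz orbT.
elim=> {h b} [_ c|_ a b _ [h1 IH1] _ [h2 IH2]|_ z a zz _ [h IH]].
- elim/poly_ind: c => [|p c [h IH]].
    by exists 0%N; rewrite rmorph0 -(rmorph0 iota); exact: poly_le_const.
  exists h.+1; rewrite rmorphD rmorphM; apply: poly_le_add.
    rewrite evmX mulrC; apply: poly_le_gen; first exact: mem_head.
    exact: IH.
  by rewrite evmC; exact: poly_le_const.
- exists (maxn h1 h2); apply: poly_le_add.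
    by apply: poly_le_mono IH1 => //; exact: leq_maxl.
  by apply: poly_le_mono IH2 => //; exact: leq_maxr.
- by exists h.+1; apply: poly_le_gen => //; exact: sub.
Qed.

(** A nonzero polynomial vanishing at [z] over the innermost ring of scalars is the relation; its
    leading coefficient stays nonzero because [xs] is independent. *)
Lemma alg_dependence xs z (k : idomainType) (iota : {rmorphism k -> R}) :
  alg_indep xs iota -> ~ alg_indep (rcons xs z) iota ->
  exists (e h : nat) (b : nat -> R),
    [/\ (forall i, (i <= e)%N -> poly_le iota xs h (b i)), b e != 0 &
        \sum_(i < e.+1) b i * z ^+ i = 0].
Proof.
elim: xs k iota => [|x xs IH] k iota /=.
  move=> ii ni; have [p p0 Ep] : exists2 p, p != 0 & evm iota z p = 0.
    apply: contrapT => no; apply: ni => p q E.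
    apply/eqP; rewrite -subr_eq0; apply: contrapT => /negP p0; apply: no.
    by exists (p - q) => //; rewrite rmorphB; apply/eqP; rewrite subr_eq0; apply/eqP.
  exists (size p).-1, 0%N, (fun i => iota p`_i); split.
  - by move=> i _; exact: poly_le_const.
  - rewrite -(rmorph0 iota) (inj_eq ii) -/(lead_coef p) lead_coef_eq0.
    exact: p0.
  - rewrite prednK ?lt0n ?size_poly_eq0; last exact: p0.
    rewrite -[RHS]Ep evmE -[p in RHS]coefK poly_def rmorph_sum horner_sum.
    apply: eq_bigr => i _.
    by rewrite -mul_polyC rmorphM /= map_polyC map_polyXn hornerM hornerC hornerXn.
move=> a1 a2; have [e [h [b [hb be E]]]] := IH _ _ a1 a2.
suff /(_ e (leqnn e))[h' hb'] : forall n, (n <= e)%N ->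
    exists h', forall i, (i <= n)%N -> poly_le iota (x :: xs) h' (b i).
  by exists e, h', b.
elim=> [|n IHn] ne.
  have [h' h'b] := poly_le_evm (hb 0%N isT).
  by exists h' => i; rewrite leqn0 => /eqP ->.
have [h1 hb1] := IHn (ltnW ne); have [h2 hb2] := poly_le_evm (hb _ ne).
exists (maxn h1 h2) => i; rewrite leq_eqVlt => /predU1P[->|lt].
  by apply: poly_le_mono hb2 => //; exact: leq_maxr.
by apply: poly_le_mono (hb1 i lt) => //; exact: leq_maxl.
Qed.

Section AddGenerator.
Context (k : idomainType) (iota : {rmorphism k -> R}) (z : R) (zs : seq R).

(** The degree in [z] has its own bound [e], which stays fixed while [n] grows when [z] is
    algebraic. *)
Definition poly_gen e n (y : R) : Prop := exists q : nat -> R,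
  (forall i, (i < e)%N -> poly_le iota zs n (q i)) /\ y = \sum_(i < e) q i * z ^+ i.

Lemma poly_gen_mono e e' n n' y : (e <= e')%N -> (n <= n')%N ->
  poly_gen e n y -> poly_gen e' n' y.
Proof.
move=> le le' [q [hq ->]]; exists (fun i => if (i < e)%N then q i else 0); split.
  move=> i _; case: ifP => [/hq|_]; first exact: poly_le_mono.
  by rewrite -(rmorph0 iota); exact: poly_le_const.
rewrite -(subnKC le) big_split_ord /= [X in _ = _ + X]big1 ?addr0.
  by apply: eq_bigr => i _; rewrite ltn_ord.
by move=> i _; rewrite ltnNge leq_addr /= mul0r.
Qed.

Lemma poly_gen_add e n y y' : poly_gen e n y -> poly_gen e n y' ->
  poly_gen e n (y + y').
Proof.
move=> [q [hq ->]] [q' [hq' ->]]; exists (fun i => q i + q' i); split.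
  by move=> i ie; apply: poly_le_add; [exact: hq|exact: hq'].
by rewrite -big_split; apply: eq_bigr => i _; rewrite mulrDl.
Qed.

Lemma poly_gen_coef e n c : (0 < e)%N -> poly_le iota zs n c -> poly_gen e n c.
Proof.
move=> e0 hc; apply: (@poly_gen_mono 1 e n n) => //.
by exists (fun=> c); split=> //; rewrite big_ord1 expr0 mulr1.
Qed.

Lemma poly_gen_mul e n m c y : poly_le iota zs m c -> poly_gen e n y ->
  poly_gen e (m + n) (c * y).
Proof.
move=> hc [q [hq ->]]; exists (fun i => c * q i); split.
  by move=> i /hq; exact: poly_le_mul.
by rewrite mulr_sumr; apply: eq_bigr => i _; rewrite mulrA.
Qed.

Lemma poly_gen_shift e n y : poly_gen e n y -> poly_gen e.+1 n (z * y).
Proof.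
case=> q [hq ->]; exists (fun i => if i is j.+1 then q j else 0); split.
  move=> [|i] /=; last exact: hq.
  by move=> _; rewrite -(rmorph0 iota); exact: poly_le_const.
rewrite big_ord_recl mul0r add0r mulr_sumr; apply: eq_bigr => i _ /=.
by rewrite exprS mulrCA.
Qed.

(** The relation eliminates the top power of [z], at the price of a factor [b e.+1] and of [h] more
    degrees in the old generators. *)
Lemma poly_gen_reduce e h n (b : nat -> R) y :
  (forall i, (i <= e.+1)%N -> poly_le iota zs h (b i)) ->
  \sum_(i < e.+2) b i * z ^+ i = 0 ->
  poly_gen e.+2 n y -> poly_gen e.+1 (h + n) (b e.+1 * y).
Proof.
move=> hb Eb [q [hq ->]].
have Ez : b e.+1 * z ^+ e.+1 = \sum_(i < e.+1) (- b i) * z ^+ i.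
  move: Eb; rewrite big_ord_recr /= => /eqP; rewrite addrC addr_eq0 => /eqP ->.
  by rewrite -sumrN; apply: eq_bigr => i _; rewrite mulNr.
have -> : b e.+1 * (\sum_(i < e.+2) q i * z ^+ i) =
    b e.+1 * (\sum_(i < e.+1) q i * z ^+ i) +
    q e.+1 * (\sum_(i < e.+1) (- b i) * z ^+ i).
  by rewrite big_ord_recr /= mulrDr -Ez; congr (_ + _); ring.
apply: poly_gen_add.
  apply: poly_gen_mul; first exact: hb.
  by exists q; split=> // i ie; apply: hq; exact: leqW.
rewrite addnC; apply: poly_gen_mul; first exact: hq.
exists (fun i => - b i); split=> // i ie.
by rewrite -mulN1r -(rmorph1 iota) -rmorphN; apply/poly_le_scale/hb/ltnW.
Qed.

Lemma in_span_poly_gen e n g (t : seq R) y :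
  (forall p, poly_le iota zs n p -> in_span iota t (g * p)) ->
  poly_gen e n y ->
  in_span iota [seq a * z ^+ i | a <- t, i <- seq.iota 0 e] (g * y).
Proof.
move=> ht [q [hq ->]]; rewrite mulr_sumr.
have sS := in_span_submod iota [seq a * z ^+ i | a <- t, i <- seq.iota 0 e].
apply: (submod_sum _ sS) => i _; rewrite mulrA.
apply: (in_span_min (W := fun a => in_span iota _ (a * z ^+ i)) _ _ (ht _ (hq i _))) => //.
  case: sS => S0 SD SZ; split; first by rewrite mul0r.
    by move=> a b ha hb; rewrite mulrDl; exact: SD.
  by move=> c a ha; rewrite -mulrA; exact: SZ.
move=> a ha; apply: mem_in_span; apply/allpairsP; exists (a, val i).
by rewrite mem_iota ltn_ord.
Qed.

End AddGenerator.

(* A generator [z] that is algebraic over [k[xs]] satisfies a relation with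
   leading coefficient [b]; multiplying by [b ^+ n] rewrites every polynomial
   of degree [<= n] in terms of finitely many powers of [z]. *)
Theorem growth (k : idomainType) (iota : {rmorphism k -> R}) zs :
  injective iota -> exists xs C, [/\ {subset xs <= zs}, alg_indep xs iota &
    forall n, exists g t, [/\ g != 0, (size t <= C * n.+1 ^ size xs)%N &
      forall p, poly_le iota zs n p -> in_span iota t (g * p)]].
Proof.
move=> ii; elim: zs => [|z zs [xs [C [sxs ai hC]]]].
  exists [::], 1%N; split=> // n; exists 1, [:: 1]; split=> //.
    exact: oner_neq0.
  move=> p h; rewrite mul1r; elim: h => {n p} [n c|n a b _ IHa _ IHb|//].
    by exists c; rewrite mulr1 subrr.
  by case: (in_span_submod iota [:: 1]) => _ SD _; exact: SD.
have sub : {subset zs <= z :: zs} by move=> y hy; rewrite inE hy orbT.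
have [ai'|/(alg_dependence ai)[[|e] [h [b [hb be Eb]]]]] :=
    pselect (alg_indep (rcons xs z) iota).
- exists (rcons xs z), C; split=> //.
    by move=> y; rewrite mem_rcons !inE => /predU1P[->|/sxs ->]; rewrite ?eqxx ?orbT.
  move=> n; have [g [t [g0 st ht]]] := hC n.
  (* For transcendental [z] all powers up to [n] are kept, which raises the exponent of [n.+1] by
     one. *)
  exists g, [seq a * z ^+ i | a <- t, i <- seq.iota 0 n.+1]; split=> //.
    rewrite size_allpairs size_iota size_rcons expnSr mulnA.
    by rewrite leq_mul2r st orbT.
  move=> p hp; apply: in_span_poly_gen ht _.
  elim: hp => {p g t g0 st} [m c|m a a' _ IHa _ IHb|m y a yz _ IH].
  + by apply: poly_gen_coef => //; exact: poly_le_const.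
  + exact: poly_gen_add.
  + move: yz; rewrite inE => /predU1P[->|yz].
      by apply: poly_gen_mono (poly_gen_shift IH).
    have hy : poly_le iota zs 1 y.
      rewrite -[y]mulr1 -(rmorph1 iota).
      by apply: poly_le_gen => //; exact: poly_le_const.
    exact: poly_gen_mono (poly_gen_mul hy IH).
- by move: Eb; rewrite big_ord1 expr0 mulr1 => b0; rewrite b0 eqxx in be.
have {}hb i : (i <= e.+1)%N -> poly_le iota zs h (b i).
  by move=> /hb; exact: poly_le_mono.
(* [e.+1] powers of [z] remain, and multiplying by [b e.+1 ^+ n] raises degrees from [n] to at most
   [n * h.+1], whence the factor [h.+1 ^ size xs]. *)
exists xs, (e.+1 * C * h.+1 ^ size xs)%N; split=> //.
  by move=> y /sxs; exact: sub.
move=> n; have [g [t [g0 st ht]]] := hC (n * h.+1)%N.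
exists (g * b e.+1 ^+ n), [seq a * z ^+ i | a <- t, i <- seq.iota 0 e.+1].
split.
- by rewrite mulf_neq0 // expf_neq0.
- rewrite size_allpairs size_iota mulnC -!mulnA leq_mul2l /=.
  apply: leq_trans st _; rewrite leq_mul2l -expnMn; apply/orP; right.
  by case: (size xs) => [//|d]; rewrite leq_exp2r //; nia.
move=> p hp; rewrite -mulrA; apply: in_span_poly_gen ht _.
elim: hp => {p g t g0 st} [m c|m a a' _ IHa _ IHb|m y a yz _ IH].
+ apply: poly_gen_coef => //; rewrite mulrC; apply: poly_le_scale.
  apply: poly_le_mono (poly_le_exp m (hb _ (leqnn _))) => //.
  by rewrite leq_mul2l leqnSn orbT.
+ by rewrite mulrDr; exact: poly_gen_add.
+ rewrite exprS mulSn; move: yz; rewrite inE => /predU1P[->|yz].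
    rewrite (_ : _ * (z * a) = b e.+1 * (z * (b e.+1 ^+ m * a))); last by ring.
    have := poly_gen_reduce hb Eb (poly_gen_shift IH).
    by apply: poly_gen_mono => //; rewrite leq_add2r.
  rewrite (_ : _ * (y * a) = (y * b e.+1) * (b e.+1 ^+ m * a)); last by ring.
  by apply: poly_gen_mul IH; apply: poly_le_gen => //; exact: hb.
Qed.

End Growth.

(** * Graded algebras *)

Section DomainOfIntegral.
Context (K : fieldType) (A : comAlgType K) (intA : integral_alg A).

Let invA (x : A) : A :=
  if pselect (exists y, y * x = 1) is left h then projT1 (cid h) else x.

Let unitA : pred A := fun x => `[< exists y, y * x = 1 >].

Let mulVA : {in unitA, left_inverse 1 invA *%R}.
Proof.
move=> x /asboolP h; rewrite /invA; case: pselect => // h'.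
exact: projT2 (cid h').
Qed.

Let unitAP (x y : A) : y * x = 1 -> unitA x.
Proof. by move=> h; apply/asboolP; exists y. Qed.

Let invA_out : {in [predC unitA], invA =1 id}.
Proof.
by move=> x /negP h; rewrite /invA; case: pselect => // h'; case: h; apply/asboolP.
Qed.

Let mulA_eq0 (x y : A) : x * y = 0 -> (x == 0) || (y == 0).
Proof. by case/(intA.2) => ->; rewrite eqxx ?orbT. Qed.

Let comUnitA : comUnitRingType := HB.pack (A : Type) (GRing.ComNzRing.class A)
  (@GRing.ComNzRing_hasMulInverse.Build A unitA invA mulVA unitAP invA_out).

Definition domain_of_integral : idomainType :=
  HB.pack (A : Type) (GRing.ComUnitRing.class comUnitA)
    (@GRing.ComUnitRing_isIntegral.Build comUnitA mulA_eq0).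

Let toD : {rmorphism A -> domain_of_integral} :=
  GRing.RMorphism.clone A domain_of_integral (idfun : A -> A) _.

(** Integrality is only a proposition about [A]; a classically chosen inverse on units makes [A] an
    [idomainType], which has a fraction field. *)
Lemma integral_embedding :
  exists (Fr : fieldType) (phi : {rmorphism A -> Fr}), injective phi.
Proof.
exists {fraction domain_of_integral}, (@FracField.tofrac domain_of_integral \o toD).
move=> x y /eqP /=.
by rewrite tofrac_eq => /eqP.
Qed.

End DomainOfIntegral.

Section LinFree.
Context (K : fieldType) (A : comAlgType K) (Fr : fieldType).
Context (phi : {rmorphism A -> Fr}) (phi_inj : injective phi).

Definition scalar_map : {rmorphism K -> Fr} := phi \o in_alg A.

Lemma scalar_mapE c a : phi (c *: a) = scalar_map c * phi a.
Proof. by rewrite -[in LHS](mulr_algl c a) rmorphM. Qed.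

Lemma lin_free_indep s : lin_free s <-> indep scalar_map (map phi s).
Proof.
have e := size_map phi s.
have E (c : 'I_(size s) -> K) :
    phi (\sum_i c i *: s`_i) =
    \sum_i scalar_map (c (cast_ord e i)) * (map phi s)`_i.
  rewrite rmorph_sum (reindex (cast_ord e)) /=; last first.
    by apply: onW_bij; exists (cast_ord (esym e)); [exact: cast_ordK|exact: cast_ordKV].
  apply: eq_bigr => i _; rewrite scalar_mapE; congr (_ * _).
  by rewrite (nth_map 0) // -e.
split=> [h|/indepP h c E0 i].
  apply/indepP => c Ec i.
  have := h (c \o cast_ord (esym e)).
  have -> : \sum_(i < size s) (c \o cast_ord (esym e)) i *: s`_i = 0.
    apply: phi_inj; rewrite E rmorph0 -[RHS]Ec.
    by apply: eq_bigr => j _ /=; rewrite cast_ordK.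
  by move=> /(_ erefl (cast_ord e i)) /=; rewrite cast_ordK.
have := h (c \o cast_ord e); rewrite -E E0 rmorph0.
by move=> /(_ erefl (cast_ord (esym e) i)) /=; rewrite cast_ordKV.
Qed.

End LinFree.

Lemma sum_pad (V : zmodType) (g : nat -> V) M M' :
  (forall i, (M <= i)%N -> g i = 0) -> (M <= M')%N ->
  \sum_(i < M) g i = \sum_(i < M') g i.
Proof.
move=> gM /subnKC <-; rewrite big_split_ord /= [X in _ = _ + X]big1 ?addr0 // => i _.
by apply: gM; exact: leq_addr.
Qed.

Lemma sum_delta (V : zmodType) (a : V) n M : (n < M)%N ->
  \sum_(i < M) (if val i == n then a else 0) = a.
Proof.
move=> nM; rewrite (bigD1 (Ordinal nM)) //= eqxx big1 ?addr0 // => i.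
by rewrite -val_eqE /= => /negPf ->.
Qed.

Section GradedGenerators.
Context (K : fieldType) (A : comAlgType K).

Lemma subspace_sum (W : A -> Prop) (I : Type) (r : seq I) (P : pred I) (F : I -> A) :
  is_subspace W -> (forall i, P i -> W (F i)) -> W (\sum_(i <- r | P i) F i).
Proof.
case=> W0 WZ WF; apply: big_ind => // a b Wa Wb.
by rewrite -[a]scale1r; exact: WZ.
Qed.

Lemma subspaceZ (W : A -> Prop) c a : is_subspace W -> W a -> W (c *: a).
Proof. by case=> W0 WZ Wa; rewrite -[_ *: _]addr0; exact: WZ. Qed.

Inductive homog (Z : seq A) : nat -> A -> Prop :=
| homog1 : homog Z 0 1
| homog0 n : homog Z n 0
| homogP n c a b : homog Z n a -> homog Z n b -> homog Z n (c *: a + b)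
| homogM n z a : z \in Z -> homog Z n a -> homog Z n.+1 (z * a).

Lemma homog_subspace Z n : is_subspace (homog Z n).
Proof. by split=> [|c u v]; [exact: homog0|exact: homogP]. Qed.

Lemma homog_prod (Z t : seq A) : {subset t <= Z} -> homog Z (size t) (\prod_(x <- t) x).
Proof.
elim: t => [|x t IH] sub; first by rewrite big_nil; exact: homog1.
rewrite big_cons; apply: homogM; first by apply: sub; exact: mem_head.
by apply: IH => y hy; apply: sub; rewrite inE hy orbT.
Qed.

Inductive homog_sum (Z : seq A) : A -> Prop :=
| homog_sum0 : homog_sum Z 0
| homog_sumD n a b : homog Z n a -> homog_sum Z b -> homog_sum Z (a + b).

Lemma homog_sum_add Z a b : homog_sum Z a -> homog_sum Z b -> homog_sum Z (a + b).
Proof.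
move=> + hb; elim=> [|n a' b' ha _ IH]; first by rewrite add0r.
by rewrite -addrA; exact: homog_sumD ha IH.
Qed.

Lemma homog_sum_homog Z n a : homog Z n a -> homog_sum Z a.
Proof. by move=> h; rewrite -[a]addr0; apply: homog_sumD h (homog_sum0 _). Qed.

Lemma homog_sum_scale Z c a : homog_sum Z a -> homog_sum Z (c *: a).
Proof.
elim=> [|n a' b' ha _ IH]; first by rewrite scaler0; exact: homog_sum0.
rewrite scalerDr; apply: homog_sumD IH.
exact: subspaceZ (homog_subspace Z n) ha.
Qed.

Lemma homog_sum_mul Z a b : homog_sum Z a -> homog_sum Z b -> homog_sum Z (a * b).
Proof.
move=> + hb; elim=> [|n a' b' ha _ IH]; first by rewrite mul0r; exact: homog_sum0.
rewrite mulrDl; apply: homog_sum_add IH.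
elim: ha => {n a' b'} [|n|n c a1 a2 _ IH1 _ IH2|n z a1 zZ _ IH].
- by rewrite mul1r.
- by rewrite mul0r; exact: homog_sum0.
- rewrite mulrDl -scalerAl; apply: homog_sum_add IH2; exact: homog_sum_scale.
- rewrite -mulrA; elim: IH => [|m b1 b2 hb1 _ IHb].
    by rewrite mulr0; exact: homog_sum0.
  by rewrite mulrDr; apply: homog_sum_add IHb; apply: homog_sum_homog; exact: homogM hb1.
Qed.

Lemma homog_sum_gen Z (P : A -> Prop) a :
  (forall x, P x -> homog_sum Z x) -> in_alg_gen P a -> homog_sum Z a.
Proof.
move=> hP [k [c [t [tP ->]]]].
elim/big_ind: _ => [||i _]; [exact: homog_sum0|exact: homog_sum_add|].
apply: homog_sum_scale; elim: (t i) (tP i) => [|x s IH] sP.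
  by rewrite big_nil; apply: homog_sum_homog; exact: homog1.
rewrite big_cons; apply: homog_sum_mul; first by apply/hP/sP; exact: mem_head.
by apply: IH => y hy; apply: sP; rewrite inE hy orbT.
Qed.

Lemma homog_mono Z Z' n a : {subset Z <= Z'} -> homog Z n a -> homog Z' n a.
Proof.
move=> sub; elim=> {n a} [|n|n c a1 a2 _ IH1 _ IH2|n z a1 zZ _ IH].
- exact: homog1.
- exact: homog0.
- exact: homogP.
- by apply: homogM => //; exact: sub.
Qed.

Lemma homog_sum_mono Z Z' a : {subset Z <= Z'} -> homog_sum Z a -> homog_sum Z' a.
Proof.
move=> sub; elim=> [|n a' b' ha _ IH]; first exact: homog_sum0.
exact: homog_sumD (homog_mono sub ha) IH.
Qed.

Context (B : nat -> A -> Prop).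
Hypotheses (gB : graded_alg B) (ftA : finite_type_alg A) (genA : generated_by (B 1%N)).

(** Each of the finitely many algebra generators is a polynomial in elements of [B 1]; the factors
    occurring in these polynomials form [Z]. *)
Lemma finite_generators : exists Z : seq A,
  (forall z, z \in Z -> B 1%N z) /\ forall a, homog_sum Z a.
Proof.
have [s hs] := ftA.
suff [Z [hZ hsZ]] : exists Z : seq A,
    (forall z, z \in Z -> B 1%N z) /\ forall x, x \in s -> homog_sum Z x.
  by exists Z; split=> // a; apply: homog_sum_gen (hs a).
elim: (s) => [|x s' [Z [hZ hsZ]]]; first by exists [::].
have [k [c [t [tP Ex]]]] := genA x.
pose Z' := flatten [seq t i | i <- enum 'I_k].
exists (Z' ++ Z); split.
  move=> z; rewrite mem_cat => /orP[/flatten_mapP[i _ /tP]|/hZ] //.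
move=> y; rewrite inE => /predU1P[->|/hsZ]; last first.
  by apply: homog_sum_mono => z hz; rewrite mem_cat hz orbT.
apply: (@homog_sum_mono Z'); first by move=> z hz; rewrite mem_cat hz.
rewrite Ex; elim/big_ind: _ => [||i _]; [exact: homog_sum0|exact: homog_sum_add|].
apply/homog_sum_scale/homog_sum_homog/homog_prod => z hz.
by apply/flatten_mapP; exists i; rewrite ?mem_enum.
Qed.

Lemma homog_graded (Z : seq A) n a : (forall z, z \in Z -> B 1%N z) -> homog Z n a -> B n a.
Proof.
case: gB => Bs B1 BM _ _ hZ; elim=> {n a} [//|n|n c a1 a2 _ IH1 _ IH2|n z a1 zZ _ IH].
- by case: (Bs n).
- by case: (Bs n) => _; apply.
- by rewrite -add1n; apply: BM => //; exact: hZ.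
Qed.

(** Write [a] as a sum of homogeneous expressions in [Z]; by directness of the grading, the part of
    degree [n] equals [a]. *)
Lemma graded_homog (Z : seq A) n a : (forall z, z \in Z -> B 1%N z) ->
  (forall a, homog_sum Z a) -> B n a -> homog Z n a.
Proof.
move=> hZ hgen Ba; case: (gB) => Bs _ _ _ Bdir.
have [M [g [hg gM Ea]]] : exists M (g : nat -> A), [/\ forall i, homog Z i (g i),
    (forall i, (M <= i)%N -> g i = 0) & a = \sum_(i < M) g i].
  elim: (hgen a) => [|m a' b' ha' _ [M [g [hg gM ->]]]].
    by exists 0%N, (fun=> 0); split=> [i|//|]; [exact: homog0|rewrite big_ord0].
  exists (maxn M m.+1), (fun i => g i + (if i == m then a' else 0)); split.
  - move=> i; rewrite -[g i]scale1r; apply: homogP => //.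
    by case: eqP => [->//|_]; exact: homog0.
  - by move=> i; rewrite geq_max => /andP[/gM -> mi]; rewrite add0r gtn_eqF.
  rewrite big_split /= addrC; congr (_ + _).
    rewrite sum_delta //; exact: leq_maxr.
  exact: (sum_pad gM (leq_maxl _ _)).
have M' : (n < M + n.+1)%N by lia.
pose c (i : 'I_(M + n.+1)) := g i - (if val i == n then a else 0).
have hc (i : 'I_(M + n.+1)) : B i (c i).
  rewrite /c addrC -scaleN1r; case: (Bs i) => _; apply.
    by case: eqP => [->//|_]; case: (Bs i).
  exact: homog_graded hZ (hg i).
have Ec : \sum_i c i = 0.
  by rewrite sumrB sum_delta // -(sum_pad gM (leq_addr _ _)) -Ea subrr.
have := Bdir _ _ hc Ec (Ordinal M').
by rewrite /c /= eqxx => /eqP; rewrite subr_eq0 => /eqP <-.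
Qed.

(** The fact that products span [B (n + m)], as an induction principle; words in [Z] are shortened
    by one letter at a time. *)
Lemma graded_mul_ind (Z : seq A) (Y : A -> Prop) n m a : (forall z, z \in Z -> B 1%N z) ->
  (forall a, homog_sum Z a) -> is_subspace Y ->
  (forall b b', B n b -> B m b' -> Y (b * b')) -> B (n + m)%N a -> Y a.
Proof.
move=> hZ hgen; case: (gB) => Bs B1 BM _ _.
elim: n Y a => [|n IH] Y a sY hY Ba.
  by rewrite -[a]mul1r; apply: hY.
have step N a' : homog Z N.+1 a' ->
    (forall z b, z \in Z -> homog Z N b -> Y (z * b)) -> Y a'.
  move: {-1}N.+1 (erefl N.+1) => N' EN h hh.
  elim: h EN => {N' a'} [//|N' _|N' c a1 a2 _ IH1 _ IH2 EN|N' z a1 zZ ha1 _ [EN]].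
  - by case: sY.
  - by case: (sY) => _; apply; [exact: IH1|exact: IH2].
  - by apply: hh => //; rewrite EN.
apply: (step (n + m)%N); first exact: graded_homog.
move=> z b zZ hb; apply: (IH (fun b => Y (z * b))).
- case: (sY) => Y0 YZ; split; first by rewrite mulr0.
  by move=> c u v hu hv; rewrite mulrDr -scalerAr; exact: YZ.
- move=> b1 b2 hb1 hb2; rewrite mulrA; apply: hY => //.
  by rewrite -add1n; apply: BM => //; exact: hZ.
- exact: homog_graded hZ hb.
Qed.

(** If all generators vanished, [A] would consist of scalars and have no two distinct nested primes;
    this is where positive Krull dimension enters. *)
Lemma nonzero_generator (Z : seq A) : (forall a, homog_sum Z a) -> krull_dim_pos A ->
  exists2 z, z \in Z & z != 0.
Proof.
move=> hgen [P [Q [[P0 _ _ _ _] [[Q0 QB QM Q1 _] [PQ [x [Qx Px]]]]]]].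
apply: contrapT => no.
have Z0 n a : homog Z n a -> exists c, a = c *: 1.
  elim=> {n a} [|n|n c a1 a2 _ [c1 ->] _ [c2 ->]|n z a1 zZ _ _].
  - by exists 1; rewrite scale1r.
  - by exists 0; rewrite scale0r.
  - by exists (c * c1 + c2); rewrite scalerDl scalerA.
  - exists 0; rewrite scale0r; have [->|z0] := eqVneq z 0; first by rewrite mul0r.
    by case: no; exists z.
have [c Ex] : exists c, x = c *: 1.
  elim: (hgen x) => [|n a b /Z0[c ->] _ [d ->]]; first by exists 0; rewrite scale0r.
  by exists (c + d); rewrite scalerDl.
have [c0|c0] := eqVneq c 0.
  by apply: Px; rewrite Ex c0 scale0r.
apply: Q1; have := QM (c^-1 *: 1) _ Qx; rewrite Ex -scalerAl mul1r scalerA mulVf //.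
by rewrite scale1r.
Qed.

End GradedGenerators.

Section GradedDimensions.
Context (K : fieldType) (A : comAlgType K).

Definition free_in (W : A -> Prop) (m : nat) : Prop :=
  exists s : seq A, [/\ size s = m, (forall x, x \in s -> W x) & lin_free s].

Context (B : nat -> A -> Prop) (Z : seq A) (x0 : A).
Context (Fr : fieldType) (phi : {rmorphism A -> Fr}).
Hypotheses (gB : graded_alg B) (phi_inj : injective phi).
Hypotheses (hZ : forall z, z \in Z -> B 1%N z) (hgen : forall a, homog_sum Z a).
Hypotheses (x0Z : x0 \in Z) (x0_neq0 : x0 != 0).

Local Notation iota := (scalar_map phi).
Local Notation zs := [seq phi z / phi x0 | z <- Z].

Let px0 : phi x0 != 0.
Proof. by rewrite -(rmorph0 phi) (inj_eq phi_inj). Qed.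

(** Allows [growth], a statement on non-homogeneous polynomials in the ratios [z / x0], to bound the
    dimension of [B n]. *)
Lemma dehomogenize n b : B n b -> poly_le iota zs n (phi b / phi x0 ^+ n).
Proof.
move=> /(graded_homog gB hZ hgen); elim=> {n b} [|n|n c a b _ IHa _ IHb|n z a zZ _ IH].
- by rewrite expr0 divr1 !rmorph1 -(rmorph1 iota); exact: poly_le_const.
- by rewrite rmorph0 mul0r -(rmorph0 iota); exact: poly_le_const.
- rewrite rmorphD scalar_mapE mulrDl -mulrA; apply: poly_le_add IHb.
  exact: poly_le_scale.
- rewrite rmorphM exprS invfM mulrACA; apply: poly_le_gen IH.
  by apply/mapP; exists z.
Qed.

(** Each variable is homogenized to degree exactly [N], as [z ^+ b * x0 ^+ (N - b)]. *)
Lemma homogenize_monom N xs a : {subset xs <= zs} -> monom_lt N xs a ->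
  exists2 y, B (size xs * N)%N y & phi y = a * phi x0 ^+ (size xs * N).
Proof.
case: (gB) => _ B1 BM _ _.
have BX n z : B 1%N z -> B n (z ^+ n).
  by move=> hz; elim: n => [|n IH]; rewrite ?expr0 // exprS -add1n; exact: BM.
elim: xs a => [|x xs IH] a sub /=.
  by move=> ->; exists 1; rewrite // mul0n expr0 mulr1 rmorph1.
case=> b [a' [bN /IH[]]]; first by move=> y hy; apply: sub; rewrite inE hy orbT.
move=> y By Ey ->; have /mapP[z zZ Ex] := sub x (mem_head _ _).
exists (z ^+ b * x0 ^+ (N - b) * y).
  rewrite mulSn; apply: (BM) By; rewrite -{1}(subnKC (ltnW bN)).
  by apply: BM; apply: BX; exact: hZ.
have EN : phi x0 ^+ N = phi x0 ^+ b * phi x0 ^+ (N - b).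
  by rewrite -exprD subnKC // ltnW.
rewrite !rmorphM !rmorphXn Ey mulSn exprD EN.
have -> : phi z = x * phi x0 by rewrite Ex divfK.
by rewrite exprMn; ring.
Qed.

Lemma indep_free_in (W : A -> Prop) (a : Fr) m : a != 0 ->
  has_indep iota (fun w => exists2 b, W b & phi b = w * a) m -> free_in W m.
Proof.
move=> a0 [s [<- hs /(indep_mul a0) fs]].
have [t [Et Wt]] : exists t : seq A, map phi t = [seq a * x | x <- s] /\
    forall x, x \in t -> W x.
  elim: (s) hs => [|w s' IH] hs; first by exists [::].
  have [|t [Et Wt]] := IH; first by move=> x hx; apply: hs; rewrite inE hx orbT.
  have [b Wb Eb] := hs w (mem_head _ _).
  exists (b :: t); split; first by rewrite /= Et Eb mulrC.
  by move=> x; rewrite inE => /predU1P[->//|/Wt].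
exists t; split=> //; first by rewrite -(size_map phi) Et size_map.
by apply/(lin_free_indep phi_inj); rewrite Et.
Qed.

End GradedDimensions.

(** [d] is the number of independent ratios found by [growth], so it serves both bounds. The slack
    [q], absorbed by a power of [x0], lets the power inequality land in every large degree. *)
Theorem graded_dimensions (K : fieldType) (A : comAlgType K) (B : nat -> A -> Prop) :
  graded_alg B -> integral_alg A -> finite_type_alg A -> generated_by (B 1%N) ->
  krull_dim_pos A ->
  exists (d C : nat) (x0 : A), [/\ B 1%N x0, x0 != 0,
    (forall n (s : seq A), (forall x, x \in s -> B n x) -> lin_free s ->
       (size s <= C * n.+1 ^ d)%N),
    (forall (Y : A -> Prop) n m, is_subspace Y ->
       (forall b b', B n b -> B m b' -> Y (b * b')) ->
       forall a, B (n + m)%N a -> Y a) &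
    (forall N q m (E W : A -> Prop), (0 < N)%N -> is_subspace E -> is_subspace W ->
       free_in E m ->
       (forall es y, size es = N -> (forall e, e \in es -> E e) ->
          B (d * N + q)%N y -> W ((\prod_(e <- es) e) * y)) ->
       free_in W (N ^ d * m))].
Proof.
move=> gB intA ftA genA krA.
have [Fr [phi phi_inj]] := integral_embedding intA.
have [Z [hZ hgen]] := finite_generators ftA genA.
have [x0 x0Z x0n] := nonzero_generator hgen krA.
have px0 : phi x0 != 0 by rewrite -(rmorph0 phi) (inj_eq phi_inj).
have iota_inj : injective (scalar_map phi).
  exact: fmorph_inj.
have [xs [C [sxs ai hC]]] := growth [seq phi z / phi x0 | z <- Z] iota_inj.
exists (size xs), C, x0; split=> //.
- exact: hZ.
- move=> n s Bs /(lin_free_indep phi_inj) fs.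
  have [g [t [g0 st ht]]] := hC n.
  apply: leq_trans st; rewrite -(size_map phi).
  have ga : g / phi x0 ^+ n != 0 by rewrite mulf_neq0 // invr_eq0 expf_neq0.
  rewrite -(size_map (fun a => g / phi x0 ^+ n * a)).
  apply: (indep_size_le (indep_mul ga fs)) => a /mapP[w /mapP[b bs ->] ->].
  exists 1; first exact: oner_neq0.
  rewrite rmorph1 mul1r mulrAC -mulrA; apply: ht.
  by apply: (dehomogenize _ _ gB hZ hgen); exact: Bs.
- by move=> Y n m sY hY a; apply: (graded_mul_ind gB hZ hgen sY).
move=> N q m E W N0 sE sW [s [<- sE' fs]] hW.
have [E0 EZ] := sE; have [W0 WZ] := sW.
have WD a b : W a -> W b -> W (a + b).
  by move=> Wa Wb; rewrite -[a]scale1r; exact: WZ.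
have a0 : phi x0 ^+ (size xs * N + q) != 0 by rewrite expf_neq0.
apply: (indep_free_in phi_inj a0).
apply: (@indep_power_mul _ xs _ (scalar_map phi) N _
  (fun v => exists2 e, E e & phi e = v)) => //.
- split; first by exists 0; rewrite ?rmorph0.
    move=> _ _ [e he <-] [e' he' <-]; exists (e + e'); last by rewrite rmorphD.
    by rewrite -[e]scale1r; exact: EZ.
  move=> c _ [e he <-]; exists (c *: e); last by rewrite scalar_mapE.
  exact: subspaceZ.
- split; first by exists 0; rewrite ?rmorph0 ?mul0r.
    by move=> a b [e he Ee] [e' he' Ee']; exists (e + e');
      rewrite ?rmorphD ?mulrDl ?Ee ?Ee' //; exact: WD.
  move=> c a [e he Ee]; exists (c *: e); last by rewrite scalar_mapE Ee mulrA.
  exact: subspaceZ.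
- exists (map phi s); split; first by rewrite size_map.
    by move=> x /mapP[e es ->]; exists e => //; exact: sE'.
  exact/(lin_free_indep phi_inj).
move=> es a ses hes /(homogenize_monom gB phi_inj hZ x0Z x0n sxs)[y By Ey].
have [es' [Ees Ees']] : exists es' : seq A, map phi es' = es /\
    forall e, e \in es' -> E e.
  elim: (es) hes => [|w s' IH] hes; first by exists [::].
  have [|t [Et Wt]] := IH; first by move=> x hx; apply: hes; rewrite inE hx orbT.
  have [b Wb Eb] := hes w (mem_head _ _).
  exists (b :: t); split; first by rewrite /= Et Eb.
  by move=> x; rewrite inE => /predU1P[->//|/Wt].
exists ((\prod_(e <- es') e) * (y * x0 ^+ q)).
  apply: hW => //; first by rewrite -ses -Ees size_map.
  case: (gB) => _ B1 BM _ _; apply: (BM) => //.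
  by elim: q {a0} => [|q IH]; rewrite ?expr0 // exprS -add1n; apply: BM => //; exact: hZ.
by rewrite !rmorphM rmorphXn Ey -Ees big_map rmorph_prod exprD; ring.
Qed.

(** * Filtrations *)

Section FreeIn.
Context (K : fieldType) (A : comAlgType K).

Lemma free_inS (V W : A -> Prop) m : (forall a, V a -> W a) -> free_in V m -> free_in W m.
Proof. by move=> VW [s [sz Vs fs]]; exists s; split=> // x /Vs/VW. Qed.

Lemma lin_free_cons (W : A -> Prop) s a : is_subspace W -> (forall x, x \in s -> W x) ->
  lin_free s -> ~ W a -> lin_free (a :: s).
Proof.
move=> sW Ws fs Wa c; rewrite big_ord_recl /= => E.
have Wsum : W (\sum_(i < size s) c (lift ord0 i) *: s`_i).
  apply: (subspace_sum _ sW) => i _; apply: (subspaceZ _ sW).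
  by apply: Ws; exact: mem_nth.
have c0 : c ord0 = 0.
  apply/eqP; apply: contrapT => /negP c0; apply: Wa.
  have -> : a = - (c ord0)^-1 *: \sum_(i < size s) c (lift ord0 i) *: s`_i.
    move/eqP: E; rewrite addr_eq0 => /eqP E.
    by rewrite scaleNr -scalerN -E scalerA mulVf // scale1r.
  exact: subspaceZ.
move: E; rewrite c0 scale0r add0r => /(fs (c \o lift ord0)) E i.
by case: (unliftP ord0 i) => [j|] -> //; exact: E.
Qed.

Lemma free_in_eq (V W : A -> Prop) m : is_subspace V -> (forall a, V a -> W a) ->
  free_in V m -> ~ free_in W m.+1 -> forall a, W a -> V a.
Proof.
move=> sV VW [s [sz Vs fs]] nW a Wa; apply: contrapT => Va; apply: nW.
exists (a :: s); split; first by rewrite /= sz.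
  by move=> x; rewrite inE => /predU1P[->//|/Vs/VW].
exact: lin_free_cons Va.
Qed.

Lemma free_in0 (W : A -> Prop) : free_in W 0.
Proof. by exists [::]; split=> // c _ []. Qed.

Lemma free_in1 (W : A -> Prop) a : W a -> a != 0 -> free_in W 1.
Proof.
move=> Wa a0; exists [:: a]; split=> //; first by move=> x; rewrite inE => /eqP ->.
move=> c; rewrite big_ord1 /= => /eqP; rewrite scaler_eq0 (negPf a0) orbF => /eqP h i.
by rewrite ord1.
Qed.

Lemma max_free_in (W : A -> Prop) M :
  (forall s : seq A, (forall x, x \in s -> W x) -> lin_free s -> (size s <= M)%N) ->
  exists d, has_dim W d.
Proof.
move=> hM.
have ex : exists n, `[< free_in W n >] by exists 0%N; apply/asboolP; exact: free_in0.
have bd n : `[< free_in W n >] -> (n <= M)%N.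
  by move=> /asboolP[s [<- Ws fs]]; exact: hM.
case: (ex_maxnP ex bd) => d /asboolP[s [sz Ws fs]] hd; exists d; split.
  by exists s.
by move=> t Wt ft; apply: hd; apply/asboolP; exists t.
Qed.

Lemma has_dim_free_in (W : A -> Prop) d m : has_dim W d -> free_in W m -> (m <= d)%N.
Proof. by case=> _ h [s [<- Ws fs]]; exact: h. Qed.

Lemma free_in_dim (W : A -> Prop) d : has_dim W d -> free_in W d.
Proof. by case=> -[s [sz [Ws fs]]] _; exists s. Qed.

End FreeIn.

(** * Dyadic control of the defect [f] *)

Section ErrorTerms.
Context (R : realType) (f : nat -> R).
Hypotheses (f_ge0 : forall n, 0 <= f n) (f_mono : forall n m, (n <= m)%N -> f n <= f m).
Hypothesis f_cvg : cvgn (series (fun a : nat => f (2 ^ a)%N / (2 ^ a)%:R)).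

Local Notation u := (fun a : nat => f (2 ^ a)%N / (2 ^ a)%:R).

Lemma dyadic_tail (e : R) : 0 < e ->
  exists b0, forall b a, (b0 <= b)%N -> \sum_(i < a) u (b + i)%N <= e.
Proof.
move=> e0; have u0 a : 0 <= u a by rewrite divr_ge0.
have nd : nondecreasing_seq (series u).
  by apply/nondecreasing_seqP => n; rewrite seriesSr lerDl.
have /cvgrPdist_le/(_ _ e0)[b0 _ hb0] := f_cvg.
exists b0 => b a hb.
have h1 : series u (b + a)%N <= limn (series u) by exact: nondecreasing_cvgn_le.
have := hb0 b hb; rewrite ger0_norm ?subr_ge0; last exact: nondecreasing_cvgn_le.
have -> : \sum_(i < a) u (b + i)%N = series u (b + a)%N - series u b.
  elim: a {h1} => [|a IH]; first by rewrite big_ord0 addn0 subrr.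
  by rewrite big_ord_recr /= IH addnS seriesSr addrAC.
lra.
Qed.

Lemma dyadic_scale (p : nat) : (0 < p)%N ->
  let b := (trunc_log 2 p).+1 in (p <= 2 ^ b)%N /\ (2 ^ b <= 2 * p)%N.
Proof.
by move=> p0 /=; split; [exact/ltnW/trunc_log_ltn|rewrite expnS leq_mul2l /= trunc_logP].
Qed.

Lemma f_pow b : f (2 ^ b)%N = u b * (2 ^ b)%:R.
Proof. by rewrite divfK // pnatr_eq0 expn_eq0. Qed.

(** By monotonicity [f] may be evaluated at a power of two between [n] and [2 * n], where
    [f (2 ^ b) = u b * 2 ^ b] with [u b] small. *)
Lemma f_small (e : R) : 0 < e -> exists n0, forall n, (n0 <= n)%N -> f n <= e * n%:R.
Proof.
move=> e0; have [|b0 hb0] := @dyadic_tail (e / 2); first by rewrite divr_gt0.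
exists (2 ^ b0)%N => n hn.
have n0 : (0 < n)%N by apply: leq_trans hn; rewrite expn_gt0.
have [h1 h2] := dyadic_scale n0; set b := (trunc_log 2 n).+1 in h1 h2.
have hb : (b0 <= b)%N by apply: leqW; exact: trunc_log_max.
have := hb0 b 1%N hb; rewrite big_ord1 /= addn0 => hu.
apply: le_trans (f_mono h1) _; rewrite f_pow.
have h2R : (2 ^ b)%:R <= 2 * n%:R :> R by rewrite -natrM ler_nat.
apply: le_trans (ler_wpM2r _ hu) _ => //.
apply: le_trans (ler_wpM2l _ h2R) _; first lra.
by lra.
Qed.

(** Loss of index in a product of fewer than [2 ^ a.+1] elements of degree [p], multiplied by
    halving: the losses of both halves, plus up to four values of [f] for joining them and one odd
    factor. *)
Fixpoint prod_err (p a : nat) : R :=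
  if a is a'.+1 then 2 * prod_err p a' + 4 * f (2 ^ a'.+2 * p)%N else 0.

Lemma prod_err_ge0 p a : 0 <= prod_err p a.
Proof. by elim: a => //= a IH; rewrite addr_ge0 ?mulr_ge0. Qed.

(** Unrolled, the recursion is at most a constant times [2 ^ a * p] times a tail of the dyadic
    series, small uniformly in [a]. *)
Lemma prod_err_small (e : R) : 0 < e -> exists p0, forall p a, (p0 <= p)%N ->
  prod_err p a <= (2 ^ a)%:R * p%:R * e.
Proof.
(* [16] is the [8] in [key] times the [2] in [2 ^ b <= 2 * p]. *)
move=> e0; have [|b0 hb0] := @dyadic_tail (e / 16); first by rewrite divr_gt0.
exists (2 ^ b0)%N => p a hp.
have p0 : (0 < p)%N by apply: leq_trans hp; rewrite expn_gt0.
have [h1 h2] := dyadic_scale p0; set b := (trunc_log 2 p).+1 in h1 h2.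
have hb : (b0 <= b.+2)%N by do 3 apply: leqW; exact: trunc_log_max.
have h2R : (2 ^ b)%:R <= 2 * p%:R :> R by rewrite -natrM ler_nat.
have key : prod_err p a <= (2 ^ a)%:R * (2 ^ b)%:R * 8 * \sum_(i < a) u (b.+2 + i)%N.
  elim: a => [|a IH]; first by rewrite big_ord0 mulr0.
  rewrite big_ord_recr /= mulrDr; apply: lerD.
    rewrite expnS natrM -!mulrA; apply: ler_wpM2l => //.
    by rewrite !mulrA.
  have hf : f (2 ^ a.+2 * p)%N <= f (2 ^ (b.+2 + a))%N.
    by apply: f_mono; rewrite (_ : b.+2 + a = a.+2 + b)%N ?expnD ?leq_mul2l ?h1 ?orbT //; lia.
  apply: le_trans (ler_wpM2l _ hf) _ => //; rewrite [X in _ * X <= _]f_pow /=.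
  move: (_ / _) => U; rewrite !addSn !expnS expnD !natrM.
  by rewrite le_eqVlt; apply/orP; left; apply/eqP; ring.
apply: le_trans key _.
have hs := hb0 b.+2 a hb.
have ha : 0 <= (2 ^ a)%:R :> R by [].
have hbb : 0 <= (2 ^ b)%:R :> R by [].
apply: le_trans (ler_wpM2l _ hs) _; first by rewrite !mulr_ge0.
rewrite -!mulrA; apply: ler_wpM2l => //; nra.
Qed.

End ErrorTerms.

Lemma arch_nat (R : realType) (x y : R) : 0 < y -> exists N, forall n, (N <= n)%N -> x <= n%:R * y.
Proof.
move=> y0; exists (Num.trunc (`|x| / y)).+1 => n hn.
have h : `|x| / y < n%:R.
  apply: lt_le_trans (_ : (Num.trunc (`|x| / y)).+1%:R <= _); last by rewrite ler_nat.
  exact: truncnS_gt.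
by apply: le_trans (ler_norm x) _; rewrite -ler_pdivrMr // ltW.
Qed.

(** Divide [n - q0] by [p + r]; the remainder and [q0] go to [q], which stays bounded independently
    of [n]. *)
Lemma nat_split (n q0 p r : nat) : (0 < p)%N -> (q0 + p + r <= n)%N ->
  exists k q, [/\ (1 <= k)%N, n = (k * p + (r * k + q))%N,
    (q0 <= r * k + q)%N, (q <= q0 + p + r)%N & (p <= k * p)%N].
Proof.
move=> p0 nq; have pd0 : (0 < p + r)%N by lia.
pose k := ((n - q0) %/ (p + r))%N; exists k, (n - k * (p + r))%N.
have k1 : (1 <= k)%N by rewrite divn_gt0 //; lia.
have Ek := divn_eq (n - q0) (p + r); rewrite -/k in Ek.
have hmod : ((n - q0) %% (p + r) < p + r)%N by rewrite ltn_mod.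
by split=> //; nia.
Qed.

(** * Products in the filtered algebra and comparison of dimensions *)

Section Filtered.
Context (R : realType) (K : fieldType) (A : comAlgType K).
Context (f : nat -> R) (B : nat -> A -> Prop) (F : nat -> R -> A -> Prop).
Hypotheses (f_ge0 : forall n, 0 <= f n) (f_mono : forall n m, (n <= m)%N -> f n <= f m).
Hypothesis f_cvg : cvgn (series (fun a : nat => f (2 ^ a)%N / (2 ^ a)%:R)).
Hypothesis filtF : forall n, (1 <= n)%N -> good_filtration (B n) (F n).
Context (N0 : nat).
Hypothesis mulF : forall n m : nat, (N0 <= n)%N -> (N0 <= m)%N ->
  forall (s t : R) (a b : A), F n s a -> F m t b ->
    F (n + m)%N (s + t - f n - f m) (a * b).

Context (d C : nat).
Hypothesis dimB : forall n (s : seq A), (forall x, x \in s -> B n x) -> lin_free s ->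
  (size s <= C * n.+1 ^ d)%N.
Hypothesis mulB : forall (Y : A -> Prop) n m, is_subspace Y ->
  (forall b b', B n b -> B m b' -> Y (b * b')) -> forall a, B (n + m)%N a -> Y a.
Hypothesis powB : forall N q m (E W : A -> Prop), (0 < N)%N ->
  is_subspace E -> is_subspace W -> free_in E m ->
  (forall es y, size es = N -> (forall e, e \in es -> E e) ->
     B (d * N + q)%N y -> W ((\prod_(e <- es) e) * y)) ->
  free_in W (N ^ d * m).

Lemma Fspace n s : (1 <= n)%N -> is_subspace (F n s).
Proof. by move=> /filtF[h _ _ _ _]; case: (h s). Qed.

Lemma FB n s a : (1 <= n)%N -> F n s a -> B n a.
Proof. by move=> /filtF[h _ _ _ _]; case: (h s) => _; apply. Qed.

Lemma Fle n s t a : (1 <= n)%N -> s <= t -> F n t a -> F n s a.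
Proof. by move=> /filtF[_ h _ _ _]; exact: h. Qed.

(** Halving matters: multiplying [k] elements one at a time would lose about [f (j * p)] at step
    [j], and the sum of these need not be small against [k * p]. *)
Lemma prod_mem p s a (es : seq A) : (1 <= p)%N -> (N0 <= p)%N ->
  (0 < size es)%N -> (size es < 2 ^ a.+1)%N -> (forall e, e \in es -> F p s e) ->
  F (size es * p)%N ((size es)%:R * s - prod_err f p a) (\prod_(e <- es) e).
Proof.
move=> p1 pN; elim: a es => [|a IH] es es0 esa hes.
  case: es es0 esa hes => [//|e [|//]] _ _ hes.
  by rewrite big_seq1 mul1n mul1r subr0; apply: hes; exact: mem_head.
have [es1|es2] := leqP (size es) 1.
  case: es es0 esa hes es1 => [//|e [|//]] _ _ hes _.
  rewrite big_seq1 mul1n mul1r; apply: (@Fle _ _ s) => //.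
    by rewrite gerBl; exact: prod_err_ge0.
  by apply: hes; exact: mem_head.
set k := size es in es0 esa es2 *; pose q := (k %/ 2)%N.
have q0 : (0 < q)%N by rewrite divn_gt0.
have kq : (k = 2 * q + k %% 2)%N by rewrite mulnC -divn_eq.
have km : (k %% 2 < 2)%N by rewrite ltn_mod.
have qa : (q < 2 ^ a.+1)%N.
  by move: esa; rewrite [(2 ^ a.+2)%N]expnS; lia.
(* Two blocks of [q] factors and, when [k] is odd, a single leftover factor. *)
pose es1 := take q es; pose es3 := take q (drop q es); pose es4 := drop q (drop q es).
have Ees : es = es1 ++ es3 ++ es4 by rewrite !cat_take_drop.
have s1 : size es1 = q by rewrite size_takel // -/k; lia.
have s3 : size es3 = q by rewrite size_takel // size_drop -/k; lia.
have s4 : size es4 = (k %% 2)%N by rewrite !size_drop -/k; lia.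
have sub1 e : e \in es1 -> F p s e by move=> h; apply: hes; rewrite Ees !mem_cat h.
have sub3 e : e \in es3 -> F p s e.
  by move=> h; apply: hes; rewrite Ees !mem_cat h orbT.
have sub4 e : e \in es4 -> F p s e.
  by move=> h; apply: hes; rewrite Ees !mem_cat h !orbT.
have := IH es1; rewrite s1 => /(_ q0 qa sub1) h1.
have := IH es3; rewrite s3 => /(_ q0 qa sub3) h3.
have qpN : (N0 <= q * p)%N by apply: leq_trans pN _; rewrite leq_pmull.
have h13 := mulF qpN qpN h1 h3.
have kp : (k * p <= 2 ^ a.+2 * p)%N by rewrite leq_mul2r (ltnW esa) orbT.
have fle m : (m <= k)%N -> f (m * p) <= f (2 ^ a.+2 * p)%N.
  by move=> mk; apply: f_mono; apply: leq_trans kp; rewrite leq_mul2r mk orbT.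
have fq := fle q (ltac:(lia)); have f2q := fle (2 * q)%N (ltac:(lia)).
have f1 := fle 1%N (ltac:(lia)); rewrite mul1n in f1.
have pe0 := f_ge0 (2 ^ a.+2 * p)%N.
rewrite Ees !big_cat /= mulrA.
move: s4 sub4; case: es4 {Ees} => [|e [|? ?]] /=; last by lia.
  move=> k0 _; rewrite big_nil mulr1.
  have -> : (k * p = q * p + q * p)%N by lia.
  apply: Fle h13; first by lia.
  have -> : k%:R = 2 * q%:R :> R by rewrite -natrM; congr _%:R; lia.
  lra.
move=> k0 /(_ e (mem_head _ _)) he; rewrite big_seq1.
have q2pN : (N0 <= q * p + q * p)%N by lia.
have -> : (k * p = q * p + q * p + p)%N by lia.
apply: Fle (mulF q2pN pN h13 he); first by lia.
have -> : k%:R = 2 * q%:R + 1 :> R by rewrite -natrM natr1; congr _%:R; lia.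
have -> : (q * p + q * p = 2 * q * p)%N by lia.
lra.
Qed.

Lemma prod_mem_small (e : R) : 0 < e -> exists p0, forall p s (es : seq A),
  (p0 <= p)%N -> (0 < size es)%N -> (forall x, x \in es -> F p s x) ->
  F (size es * p)%N ((size es)%:R * (s - p%:R * e)) (\prod_(x <- es) x).
Proof.
move=> e0; have [p0 hp0] := prod_err_small f_ge0 f_mono f_cvg e0.
exists (maxn p0 (maxn 1 N0)) => p s es; rewrite !geq_max => /and3P[pp0 p1 pN] es0 hes.
have /andP[t1 t2] := trunc_log_bounds (isT : (1 < 2)%N) es0.
apply: Fle (prod_mem p1 pN es0 t2 hes); first by rewrite muln_gt0 es0.
have := hp0 p (trunc_log 2 (size es)) pp0.
have : (2 ^ trunc_log 2 (size es))%:R <= (size es)%:R :> R by rewrite ler_nat.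
have p0R : 0 <= p%:R :> R by [].
move=> h1 h2; rewrite mulrBr lerD2l lerN2; apply: le_trans h2 _.
by rewrite -mulrA; apply: ler_wpM2r h1; rewrite mulr_ge0 // ltW.
Qed.

Lemma free_in_bound n s m : (1 <= n)%N -> free_in (F n s) m -> (m <= C * n.+1 ^ d)%N.
Proof. by move=> n1 [t [<- ht ft]]; apply: dimB ft => x /ht; exact: FB. Qed.

(** Take a level of maximal dimension: lowering it adds nothing, and exhaustiveness reaches every
    element at some level. *)
Lemma filtration_full n : (1 <= n)%N -> exists s, forall a, B n a -> F n s a.
Proof.
move=> n1; case: (filtF n1) => _ _ _ exh _.
have ex : exists m, `[< exists s, free_in (F n s) m >].
  by exists 0%N; apply/asboolP; exists 0; exact: free_in0.
have bd m : `[< exists s, free_in (F n s) m >] -> (m <= C * n.+1 ^ d)%N.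
  by move=> /asboolP[s]; exact: free_in_bound.
case: (ex_maxnP ex bd) => m /asboolP[s hs] hm; exists s => a Ba.
have [t ht] := exh _ Ba; have [st|ts] := leP s t; first exact: Fle ht.
apply: (free_in_eq (W := F n t) (m := m)) => //.
- exact: Fspace.
- by move=> b; apply: Fle => //; exact: ltW.
- by move=> h; have := hm m.+1; rewrite ltnn => /(_ _)/negP[]//; apply/asboolP; exists t.
Qed.

(** Dually, at a level of minimal dimension the filtration has stabilized, and separatedness makes
    the stable space zero. *)
Lemma filtration_trivial n : (1 <= n)%N -> exists s, forall a, F n s a -> a = 0.
Proof.
move=> n1; case: (filtF n1) => _ _ sep _ _.
have ex : exists m, `[< exists s, ~ free_in (F n s) m.+1 >].
  exists (C * n.+1 ^ d)%N; apply/asboolP; exists 0 => /(free_in_bound n1).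
  by rewrite ltnn.
case: (ex_minnP ex) => m /asboolP[s hs] hm; exists s => a Fa; apply: sep => t.
have [ts|st] := leP t s; first exact: Fle Fa.
have ft : free_in (F n t) m.
  case: m hm {hs} => [|m] hm; first exact: free_in0.
  apply: contrapT => h; have := hm m; rewrite ltnn => /(_ _)/negP[]//.
  by apply/asboolP; exists t.
apply: (free_in_eq (W := F n s) (m := m)) Fa => //; first exact: Fspace.
by move=> b; apply: Fle => //; exact: ltW.
Qed.

Lemma mulB_pow (Y : A -> Prop) p k r : is_subspace Y ->
  (forall es b, size es = k -> (forall e, e \in es -> B p e) -> B r b ->
     Y ((\prod_(e <- es) e) * b)) ->
  forall a, B (k * p + r)%N a -> Y a.
Proof.
elim: k Y => [|k IH] Y sY hY a.
  by move=> Ba; have := hY [::] a; rewrite big_nil mul1r; apply.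
rewrite mulSn -addnA; apply: mulB => // b b' Bb.
apply: (IH (fun b' => Y (b * b'))).
  case: sY => Y0 YZ; split; first by rewrite mulr0.
  by move=> c u v hu hv; rewrite mulrDr -scalerAr; exact: YZ.
move=> es b1 ses hes Bb1; have := hY (b :: es) b1; rewrite big_cons mulrA; apply=> //.
  by rewrite /= ses.
by move=> e; rewrite inE => /predU1P[->//|/hes].
Qed.

(** [B n] is spanned by products of [k] elements of [B P] and one of a degree [r] in [[P, 2P)], so
    finitely many spaces determine a linear lower bound on the index. *)
Lemma filtration_lower : exists (c : R) (n1 : nat), 0 <= c /\
  forall n a, (n1 <= n)%N -> B n a -> F n (- c * n%:R) a.
Proof.
have [p0 hp0] := prod_mem_small ltr01.
have [m0 hm0] := f_small f_ge0 f_mono f_cvg ltr01.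
pose P := maxn p0 (maxn 1 N0).
have [PP0 P1 PN] : [/\ (p0 <= P)%N, (1 <= P)%N & (N0 <= P)%N].
  by rewrite /P; split; lia.
have [s [s0 hs]] : exists s, s <= 0 /\ forall r a, (P <= r < P + P)%N -> B r a -> F r s a.
  elim: {3}P => [|j [s [s0 hs]]].
    by exists 0; split=> // r a; rewrite addn0; case: ltngtP.
  have [t ht] := @filtration_full (P + j)%N (ltac:(lia)).
  exists (Num.min s t); split; first by rewrite ge_min s0.
  move=> r a rP Br; have [rj|rj] := eqVneq r (P + j)%N.
    apply: (@Fle _ _ t); [by lia|by rewrite ge_min lexx orbT|].
    by rewrite rj; apply: ht; rewrite -rj.
  apply: (@Fle _ _ s); [by lia|by rewrite ge_min lexx|].
  by apply: hs => //; lia.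
(* Since [s <= 0], the levels contribute at least [2 * s * n]; the product error [k * P] and the two
   values of [f] cost at most [n] each. *)
exists (3 - 2 * s), (maxn (P + P) m0); split; first by lra.
move=> n a; rewrite geq_max => /andP[nP nm] Ba.
(* One block fewer than possible, so that [r] is at least [P] and [mulF] applies in degree [r]. *)
pose k := (n %/ P).-1; pose r := (n - k * P)%N.
have nk : (2 <= n %/ P)%N by rewrite leq_divRL //; lia.
have k1 : (1 <= k)%N by rewrite /k; lia.
have En := divn_eq n P; have lP : (n %% P < P)%N by rewrite ltn_mod.
have Ek : (n %/ P = k.+1)%N by rewrite /k; lia.
rewrite Ek mulSn in En.
have rP : (P <= r < P + P)%N by rewrite /r; lia.
have Enr : n = (k * P + r)%N by rewrite /r; lia.
rewrite Enr in Ba; apply: (mulB_pow (Fspace _ _) _ Ba) => [|es b ses hes Bb].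
  by lia.
have h1 : F (k * P) (k%:R * (s - P%:R * 1)) (\prod_(e <- es) e).
  rewrite -ses; apply: hp0 => //; first by rewrite ses.
  by move=> x /hes; apply: hs; lia.
have kPN : (N0 <= k * P)%N by nia.
have rN : (N0 <= r)%N by lia.
have := mulF kPN rN h1 (hs _ _ rP Bb); rewrite -Enr.
apply: Fle; first by lia.
have f1 : f (k * P)%N <= n%:R.
  by rewrite -[leRHS]mul1r; apply: le_trans (hm0 n nm); apply: f_mono; lia.
have f2 : f r <= n%:R.
  by rewrite -[leRHS]mul1r; apply: le_trans (hm0 n nm); apply: f_mono; lia.
have kn : k%:R <= n%:R :> R by rewrite ler_nat; nia.
have kPn : k%:R * P%:R <= n%:R :> R by rewrite -natrM ler_nat; lia.
have n1 : 1 <= n%:R :> R by rewrite ler1n; lia.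
nra.
Qed.

(** The power inequality applied with [n = k p + (d k + q)]. The allowance [e n] is spent in
    quarters: the product of [k] factors, the two values of [f], the part [d k] (small as [p] is
    large), and the part [q] (small as [n] is large). *)
Lemma dim_compare (t e del : R) : 0 < e -> 0 < del ->
  exists p1, forall p, (p1 <= p)%N -> exists n1, forall n, (n1 <= n)%N ->
  forall m, free_in (F p (p%:R * t)) m -> exists k,
    free_in (F n (n%:R * (t - e))) (k ^ d * m) /\ (1 - del) * n%:R <= k%:R * p%:R.
Proof.
move=> e0 del0; have [c [nl [c0 hl]]] := filtration_lower.
have [|p0 hp0] := @prod_mem_small (e / 4); first by rewrite divr_gt0.
have [|m0 hm0] := @f_small _ _ f_ge0 f_mono f_cvg (e / 8); first by rewrite divr_gt0.
pose a := c + `|t|.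
have a0 : 0 <= a by rewrite addr_ge0.
have [pa hpa] := @arch_nat R (4 * d%:R * a) e e0.
have [pd hpd] := @arch_nat R (2 * d%:R) del del0.
pose q0 := maxn nl N0.
exists (maxn (maxn p0 (maxn 1 N0)) (maxn pa pd)) => p.
rewrite !geq_max => /andP[/and3P[pp0 p1 pN] /andP[/hpa ppa /hpd ppd]].
have [na hna] := @arch_nat R (4 * a * (q0 + p + d)%:R) e e0.
have [nd hnd] := @arch_nat R (2 * (q0 + p + d)%:R) del del0.
exists (maxn (maxn m0 (q0 + p + d)) (maxn na nd)) => n.
rewrite !geq_max => /andP[/andP[nm nq] /andP[/hna nna /hnd nnd]] m hm.
have [k [q [k1 En qX qle pkp]]] := nat_split p1 nq.
have [nlX NX] : (nl <= d * k + q)%N /\ (N0 <= d * k + q)%N.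
  by split; apply: leq_trans qX; [exact: leq_maxl|exact: leq_maxr].
have kpN : (N0 <= k * p)%N by exact: leq_trans pkp.
have kp_n : (k * p <= n)%N by rewrite [leqRHS]En leq_addr.
have X_n : (d * k + q <= n)%N by rewrite [leqRHS]En leq_addl.
have n1 : (1 <= n)%N by apply: leq_trans kp_n; exact: leq_trans pkp.
have EX : (d * k + q)%:R = d%:R * k%:R + q%:R :> R by rewrite natrD natrM.
have EnR : n%:R = k%:R * p%:R + (d%:R * k%:R + q%:R) :> R by rewrite {1}En natrD natrM EX.
have kpn : k%:R * p%:R <= n%:R :> R by rewrite -natrM ler_nat.
have qR : q%:R <= (q0 + p + d)%:R :> R by rewrite ler_nat.
exists k; split.
  apply: (powB (q := q) k1 _ _ hm); [exact: Fspace|exact: Fspace|].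
  move=> es y ses hes By; rewrite {1}En.
  have h1 : F (k * p) (k%:R * (p%:R * t - p%:R * (e / 4))) (\prod_(x <- es) x).
    by rewrite -ses; apply: hp0 => //; rewrite ses.
  have h2 := hl _ y nlX By.
  apply: Fle (mulF kpN NX h1 h2); first by rewrite -En.
  have f1 : f (k * p)%N <= e / 8 * n%:R by apply: le_trans (hm0 n nm); exact: f_mono.
  have f2 : f (d * k + q)%N <= e / 8 * n%:R by apply: le_trans (hm0 n nm); exact: f_mono.
  have X0 : 0 <= d%:R * k%:R + q%:R :> R by rewrite -EX.
  have ta : t + c <= a by rewrite /a addrC lerD2l ler_norm.
  have h3 := ler_wpM2l X0 ta.
  have h4 : d%:R * k%:R * a <= e / 4 * n%:R.
    have k4 : k%:R * (4 * d%:R * a) <= k%:R * (p%:R * e) by exact: ler_wpM2l.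
    have k5 : e * (k%:R * p%:R) <= e * n%:R by apply: ler_wpM2l => //; exact: ltW.
    lra.
  have h5 : q%:R * a <= e / 4 * n%:R.
    have k4 : a * q%:R <= a * (q0 + p + d)%:R by exact: ler_wpM2l.
    lra.
  have h6 : k%:R * p%:R * (e / 4) <= n%:R * (e / 4).
    by apply: ler_wpM2r => //; rewrite divr_ge0 // ltW.
  rewrite EX; rewrite EnR in h4 h5 h6 f1 f2 *.
  lra.
have k0R : 0 <= k%:R :> R by [].
(* The parts [d * k] and [q] each take at most the fraction [del / 2] of [n]. *)
have h7 : k%:R * (2 * d%:R) <= k%:R * (p%:R * del) by exact: ler_wpM2l.
have h8 : (k%:R * p%:R) * del <= n%:R * del by apply: ler_wpM2r => //; exact: ltW.
lra.
Qed.

End Filtered.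

Local Open Scope classical_set_scope.

(** The assumption makes the upper limit at most the lower limit; [L] is the supremum of the
    eventual lower bounds. *)
Lemma quasi_increasing_limit (R : realType) (U : nat -> R) (M : R) :
  (forall n, 0 <= U n) -> (forall n, U n <= M) ->
  (forall eta, 0 < eta -> exists p1, forall p, (p1 <= p)%N ->
     exists n1, forall n, (n1 <= n)%N -> U p <= U n + eta) ->
  exists L, forall eta, 0 < eta -> exists N, forall n, (N <= n)%N ->
    L - eta <= U n /\ U n <= L + eta.
Proof.
move=> U0 UM hU.
pose S := [set y : R | exists N, forall n, (N <= n)%N -> y <= U n].
have supS : has_sup S.
  split; first by exists 0, 0%N => n _.
  by exists M => y [N hN]; apply: le_trans (hN N (leqnn N)) (UM N).
exists (sup S) => eta eta0.
have [p1 hp1] := hU _ eta0.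
have [y [N hN] hy] := sup_adherent eta0 supS.
exists (maxn p1 N) => n; rewrite geq_max => /andP[/hp1[n1 hn1] nN]; split.
  exact: le_trans (ltW hy) (hN n nN).
rewrite -lerBlDr; apply: sup_upper_bound => //.
by exists n1 => m hm; rewrite lerBlDr; exact: hn1.
Qed.

Lemma bernoulli_sub (R : realFieldType) (x : R) d : 0 <= x <= 1 ->
  1 - d%:R * x <= (1 - x) ^+ d.
Proof.
move=> /andP[x0 x1]; elim: d => [|d IH]; first by rewrite mul0r subr0 expr0.
rewrite exprS; have h := ler_wpM2l (ltac:(lra) : 0 <= 1 - x) IH.
apply: le_trans h; rewrite -natr1.
have : 0 <= d%:R * (x * x) :> R by rewrite !mulr_ge0.
lra.
Qed.

(** * Normalized dimensions and their ratios *)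

Section Ratio.
Context (R : realType) (K : fieldType) (A : comAlgType K).
Context (B : nat -> A -> Prop) (F : nat -> R -> A -> Prop).
Context (d C : nat) (x0 : A).
Hypothesis gB : graded_alg B.
Hypotheses (Bx0 : B 1%N x0) (x0_neq0 : x0 != 0) (intA : integral_alg A).
Hypothesis filtF : forall n, (1 <= n)%N -> good_filtration (B n) (F n).
Hypothesis dimB : forall n (s : seq A), (forall x, x \in s -> B n x) -> lin_free s ->
  (size s <= C * n.+1 ^ d)%N.
Context (c : R) (nl : nat).
Hypothesis lowF : forall n a, (nl <= n)%N -> B n a -> F n (- c * n%:R) a.
Hypothesis cmpF : forall t e del : R, 0 < e -> 0 < del ->
  exists p1, forall p, (p1 <= p)%N -> exists n1, forall n, (n1 <= n)%N ->
  forall m, free_in (F p (p%:R * t)) m -> exists k,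
    free_in (F n (n%:R * (t - e))) (k ^ d * m) /\ (1 - del) * n%:R <= k%:R * p%:R.
Context (D : nat -> nat) (h : nat -> R -> nat).
Hypothesis hD : forall n, (1 <= n)%N -> has_dim (B n) (D n).
Hypothesis hh : forall n s, (1 <= n)%N -> has_dim (F n s) (h n s).

Lemma x0_pow n : B n (x0 ^+ n) /\ x0 ^+ n != 0.
Proof.
case: gB => _ B1 BM _ _; elim: n => [|n [IH1 IH2]].
  by rewrite expr0; split=> //; case: intA.
rewrite exprS; split; first by rewrite -add1n; exact: BM.
by apply/eqP => /(intA.2) [] E; [move: x0_neq0|move: IH2]; rewrite E eqxx.
Qed.

Lemma D_gt0 n : (1 <= n)%N -> (0 < D n)%N.
Proof.
move=> /hD /has_dim_free_in; apply; have [h1 h2] := x0_pow n.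
exact: free_in1 h1 h2.
Qed.

Lemma h_le_D n s : (1 <= n)%N -> (h n s <= D n)%N.
Proof.
move=> n1; apply: (has_dim_free_in (hD n1)).
by apply: free_inS (free_in_dim (hh s n1)) => a; exact: (FB filtF n1).
Qed.

Lemma h_full n s : (1 <= n)%N -> (nl <= n)%N -> s <= - c * n%:R -> h n s = D n.
Proof.
move=> n1 nn sc; apply/eqP; rewrite eqn_leq h_le_D //=.
apply: (has_dim_free_in (hh s n1)); apply: free_inS (free_in_dim (hD n1)) => a Ba.
apply: (Fle filtF n1 sc); exact: lowF.
Qed.

Let U n : R := (D n)%:R / n%:R ^+ d.
Let H n t : R := (h n (n%:R * t))%:R / n%:R ^+ d.
Let M : R := (C * 2 ^ d)%:R.

Let H_ge0 n t : 0 <= H n t.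
Proof. by rewrite divr_ge0 // exprn_ge0. Qed.

Let U_ge0 n : 0 <= U n.
Proof. by rewrite divr_ge0 // exprn_ge0. Qed.

Let nX_gt0 n : (1 <= n)%N -> 0 < n%:R ^+ d :> R.
Proof. by move=> n1; rewrite exprn_gt0 // ltr0n. Qed.

Let H_le_U n t : (1 <= n)%N -> H n t <= U n.
Proof.
by move=> n1; rewrite ler_wpM2r ?invr_ge0 ?exprn_ge0 // ler_nat h_le_D.
Qed.

Let U_le_M n : (1 <= n)%N -> U n <= M.
Proof.
move=> n1; rewrite ler_pdivrMr ?nX_gt0 // -natrX -natrM ler_nat.
have [s [<- Bs fs]] := free_in_dim (hD n1).
apply: leq_trans (dimB Bs fs) _; rewrite -mulnA leq_mul2l -expnMn.
by case: (d) => [|d'] //; rewrite ?expn0 ?orbT // leq_exp2r ?orbT //; lia.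
Qed.

Lemma H_compare_mul (t e del : R) : 0 < e -> 0 < del <= 1 ->
  exists p1, forall p, (p1 <= p)%N -> exists n1, forall n, (n1 <= n)%N ->
  (1 - d%:R * del) * H p t <= H n (t - e).
Proof.
move=> e0 /andP[del0 del1]; have [p1 hp1] := @cmpF t e del e0 del0.
exists (maxn p1 1) => p; rewrite geq_max => /andP[/hp1[n1 hn1] pp].
exists (maxn n1 1) => n; rewrite geq_max => /andP[/hn1 hn nn].
have [k [hk hkp]] := hn _ (free_in_dim (hh _ pp)).
have {}hk := has_dim_free_in (hh _ nn) hk.
apply: le_trans (_ : (1 - del) ^+ d * H p t <= _).
  by apply: ler_wpM2r => //; apply: bernoulli_sub; rewrite ltW.
rewrite ler_pdivlMr ?nX_gt0 // mulrAC -exprMn.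
apply: le_trans (_ : (k%:R * p%:R) ^+ d * H p t <= _).
  apply: ler_wpM2r => //; apply: lerXn2r => //; rewrite nnegrE ?mulr_ge0 //.
  by rewrite subr_ge0.
rewrite exprMn /H -mulrA [_ ^+ d * (_ / _)]mulrC divfK ?gt_eqF ?nX_gt0 //.
by rewrite -natrX -natrM ler_nat.
Qed.

Lemma H_compare (t e eta : R) : 0 < e -> 0 < eta ->
  exists p1, forall p, (p1 <= p)%N -> exists n1, forall n, (n1 <= n)%N ->
  H p t <= H n (t - e) + eta.
Proof.
(* As [H] is bounded by [M], this choice turns the multiplicative loss [d * del] into an additive
   one of at most [eta]. *)
move=> e0 eta0; pose del := Num.min 1 (eta / (d%:R * M + 1)).
have dM : 0 <= d%:R * M by rewrite mulr_ge0.
have dM1 : 0 < d%:R * M + 1 by lra.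
have del0 : 0 < del by rewrite lt_min ltr01 divr_gt0.
have del1 : del <= 1 by rewrite ge_min lexx.
have [|p1 hp1] := @H_compare_mul t e del e0; first by rewrite del0.
exists (maxn p1 1) => p; rewrite geq_max => /andP[/hp1[n1 hn1] pp].
exists n1 => n /hn1 hn.
have HM : H p t <= M by apply: le_trans (H_le_U _ pp) (U_le_M pp).
have : d%:R * del * H p t <= eta.
  apply: le_trans (_ : d%:R * del * M <= _).
    by apply: ler_wpM2l => //; rewrite mulr_ge0 // ltW.
  have : del * (d%:R * M + 1) <= eta.
    by rewrite -ler_pdivlMr // ge_min lexx orbT.
  lra.
lra.
Qed.

Theorem ratio_compare (t e eta : R) : 0 < e -> 0 < eta ->
  exists p1, forall p, (p1 <= p)%N -> exists n1, forall n, (n1 <= n)%N ->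
  (h p (p%:R * t))%:R / (D p)%:R <= (h n (n%:R * (t - e)))%:R / (D n)%:R + eta.
Proof.
move=> e0 eta0.
(* Below level [- c] the filtration is everything, so facts on [U] are instances of facts on [H]. *)
have HU n s : (1 <= n)%N -> (nl <= n)%N -> s <= - c -> H n s = U n.
  move=> n1 nn sc; rewrite /H h_full // mulrC ler_wpM2r //.
(* Comparison with one fixed [p]; the choice [1 / (d + 2)] keeps the factor [1 - d / (d + 2)]
   positive. *)
have [ell [ell0 [n2 hn2]]] : exists ell, 0 < ell /\ exists n2, forall n, (n2 <= n)%N -> ell <= U n.
  have [|p1 hp1] := @H_compare_mul (- c) 1 (1 / (d%:R + 2)) ltr01.
    by rewrite divr_gt0 //= ?ler_pdivrMr ?mul1r; have := ler0n R d; lra.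
  pose p := maxn p1 (maxn 1 nl).
  have [|n1 hn1] := hp1 p; first by rewrite leq_maxl.
  exists ((1 - d%:R * (1 / (d%:R + 2))) * U p); split.
    rewrite mulr_gt0 //; last first.
      by rewrite divr_gt0 ?nX_gt0 ?ltr0n ?D_gt0 //; rewrite /p; lia.
    have d0 : 0 <= d%:R :> R by [].
    have d2 : 0 < d%:R + 2 :> R by lra.
    by rewrite subr_gt0 mulrA mulr1 ltr_pdivrMr // mul1r; lra.
  exists (maxn n1 1) => n; rewrite geq_max => /andP[/hn1 hn nn].
  rewrite -(HU p (- c)) //; [|by rewrite /p; lia|by rewrite /p; lia].
  exact: le_trans hn (H_le_U _ nn).
have [L hL] : exists L, forall eta, 0 < eta -> exists N, forall n, (N <= n)%N ->
    L - eta <= U n /\ U n <= L + eta.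
  (* Nothing controls [D 0], so the value at [0] is replaced by [0]. *)
  pose U' n := if (1 <= n)%N then U n else 0.
  have [n|n|eta' e'|L hL] := @quasi_increasing_limit R U' M.
  - by rewrite /U'; case: ifP.
  - by rewrite /U'; case: ifP => [/U_le_M//|_]; rewrite /M.
  - have [p1 hp1] := @H_compare (- c) 1 eta' ltr01 e'.
    exists (maxn p1 (maxn 1 nl)) => p; rewrite !geq_max => /and3P[/hp1[n1 hn1] pp pl].
    exists (maxn n1 1) => n; rewrite geq_max => /andP[/hn1 hn nn].
    rewrite /U' pp nn -(HU p (- c)) //; apply: le_trans hn _.
    by rewrite lerD2r; exact: H_le_U.
  exists L => eta' /hL[N hN]; exists (maxn N 1) => n; rewrite geq_max => /andP[/hN + n1].
  by rewrite /U' n1.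
(* One [e1] pays for [H_compare], two for the distance between [U n] and [U p], both near [L]. *)
pose e1 := eta * ell / 3.
have e10 : 0 < e1 by rewrite divr_gt0 // mulr_gt0.
have [p1 hp1] := @H_compare t e e1 e0 e10; have [N hN] := hL _ e10.
exists (maxn (maxn p1 1) (maxn n2 N)) => p; rewrite !geq_max.
move=> /andP[/andP[/hp1[n1 hn1] pp] /andP[/hn2 lp /hN[Lp1 Lp2]]].
exists (maxn (maxn n1 1) (maxn n2 N)) => n; rewrite !geq_max.
move=> /andP[/andP[/hn1 hn nn] /andP[/hn2 ln /hN[Ln1 Ln2]]].
have E m s : (1 <= m)%N -> (h m (m%:R * s))%:R / (D m)%:R = H m s / U m.
  move=> m1; rewrite /H /U invf_div mulrA divfK // gt_eqF // nX_gt0 //.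
rewrite !E //; have Up : 0 < U p by exact: lt_le_trans lp.
have Un : 0 < U n by exact: lt_le_trans ln.
rewrite ler_pdivrMr // mulrDl.
have h1 : H n (t - e) / U n * U p >= H n (t - e) - 2 * e1.
  have q1 : H n (t - e) / U n <= 1 by rewrite ler_pdivrMr // mul1r H_le_U.
  have q0 : 0 <= H n (t - e) / U n by rewrite divr_ge0 // ltW.
  have qq : H n (t - e) = H n (t - e) / U n * U n by rewrite divfK ?gt_eqF.
  rewrite {1}qq; set Q := H n (t - e) / U n in q1 q0 *.
  have : Q * (U n - U p) <= Q * (2 * e1) by apply: ler_wpM2l => //; lra.
  have : Q * (2 * e1) <= 1 * (2 * e1) by apply: ler_wpM2r => //; lra.
  lra.
have h2 : eta * ell <= eta * U p by apply: ler_wpM2l => //; exact: ltW.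
rewrite /e1 in hn h1; lra.
Qed.

End Ratio.

(** * Convergence of the measures *)

Section StieltjesProbability.
Context (R : realType) (Fc : R -> R) (a b : R).
Hypothesis Fc_nd : {homo Fc : x y / x <= y}.
Hypothesis Fc_rc : forall x e, 0 < e -> exists2 y0, x < y0 &
  forall y, x < y -> y < y0 -> Fc y <= Fc x + e.
Hypotheses (Fc0 : forall x, x < a -> Fc x = 0) (Fc1 : forall x, b <= x -> Fc x = 1).

Let Fc_right_cont : right_continuous Fc.
Proof.
move=> x; apply/cvgrPdist_le => e e0; have [y0 xy0 hy0] := Fc_rc x e0.
near=> y.
have xy : x < y by near: y; exact: nbhs_right_gt.
have yy0 : y < y0 by near: y; exact: nbhs_right_lt.
rewrite distrC ger0_norm ?subr_ge0; last exact/Fc_nd/ltW.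
by have := hy0 y xy yy0; lra.
Unshelve. all: by end_near. Qed.

HB.instance Definition _ := isCumulative.Build R _ R Fc Fc_nd Fc_right_cont.

Let Fc_Ny : Fc @ -oo --> (0 : R).
Proof.
apply/cvgrPdist_le => e e0; near=> x; rewrite Fc0 ?subrr ?normr0 ?ltW //.
by near: x; apply: nbhs_ninfty_lt; exact: num_real.
Unshelve. all: by end_near. Qed.

Let Fc_y : Fc @ +oo --> (1 : R).
Proof.
apply/cvgrPdist_le => e e0; near=> x; rewrite Fc1 ?subrr ?normr0 ?ltW //.
by near: x; apply: nbhs_pinfty_gt; exact: num_real.
Unshelve. all: by end_near. Qed.

HB.instance Definition _ := isCumulativeBounded.Build R 0 1 Fc Fc_Ny Fc_y.

Let idTR : measurableTypeR R -> R := idfun.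

HB.instance Definition _ :=
  @isMeasurableFun.Build _ _ _ _ idTR (@measurable_id _ _ setT).

Lemma stieltjes_probability : exists nu : probability R R,
  forall s t, s <= t -> nu `]s, t] = (Fc t - Fc s)%:E.
Proof.
exists (distribution (lebesgue_stieltjes_measure Fc) idTR) => s t st.
rewrite /distribution /= /pushforward /= preimage_id.
rewrite /lebesgue_stieltjes_measure /measure_extension measurable_mu_extE /=.
  by rewrite wlength_itv_bnd.
exact: is_ocitv.
Qed.

End StieltjesProbability.

Section UnitMass.
Context (R : realType) (mu : {measure set R -> \bar R}).
Hypothesis mu1 : mu setT = 1%E.

Lemma unit_mass_fin D : measurable D -> mu D \is a fin_num.
Proof.
move=> mD; rewrite ge0_fin_numE //; apply: le_lt_trans (ltry 1).
by rewrite -mu1; apply: le_measure; rewrite ?inE.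
Qed.

Lemma fine_mass_le D E : measurable D -> measurable E -> D `<=` E ->
  fine (mu D) <= fine (mu E).
Proof.
move=> mD mE DE; rewrite fine_le ?unit_mass_fin //.
by apply: le_measure; rewrite ?inE.
Qed.

Lemma mass_split (y z : R) : y <= z ->
  fine (mu `]y, +oo[) = fine (mu `]y, z]) + fine (mu `]z, +oo[).
Proof.
move=> yz; have -> : `]y, +oo[ = `]y, z] `|` `]z, +oo[ :> set R.
  by rewrite -itv_bndbnd_setU //= bnd_simp.
rewrite measureU // ?fineD ?unit_mass_fin //.
by apply/seteqP; split=> // x /=; rewrite !in_itv /= andbT => -[/andP[_ h1] h2]; lra.
Qed.

Context (phi : R -> R) (M : R).
Hypotheses (mphi : measurable_fun setT phi) (phiM : forall x, `|phi x| <= M).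

Lemma unit_mass_integrable D : measurable D -> mu.-integrable D (EFin \o phi).
Proof.
move=> mD; apply: measurable_bounded_integrable => //.
- by rewrite -ge0_fin_numE // unit_mass_fin.
- exact: measurable_funTS.
- by exists M; split; [exact: num_real|move=> x Mx y _; exact: le_trans (ltW Mx)].
Qed.

Lemma cst_integrable D (v : R) : measurable D -> mu.-integrable D (EFin \o cst v).
Proof.
move=> mD; apply: measurable_bounded_integrable => //.
- by rewrite -ge0_fin_numE // unit_mass_fin.
- exact: bounded_cst.
Qed.

Lemma Rintegral_near_cst D (v e : R) : measurable D ->
  (forall x, D x -> `|phi x - v| <= e) ->
  `|\int[mu]_(x in D) phi x - v * fine (mu D)| <= e * fine (mu D).
Proof.
move=> mD he; rewrite -!Rintegral_cst //.
rewrite -RintegralB //; [|exact: unit_mass_integrable|exact: cst_integrable].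
have iD : mu.-integrable D (EFin \o (fun x => phi x - v)).
  have -> : EFin \o (fun x => phi x - v) = ((EFin \o phi) \- (EFin \o cst v))%E.
    by apply/funext => x; rewrite /= EFinB.
  by apply: integrableB => //; [exact: unit_mass_integrable|exact: cst_integrable].
apply: le_trans (le_normr_Rintegral mD iD) _.
apply: le_Rintegral => //; last exact: cst_integrable.
by have := integrable_abse iD.
Qed.

Lemma Rintegral_split (x y z : R) : x <= y -> y <= z ->
  \int[mu]_(t in `]x, z]) phi t =
  \int[mu]_(t in `]x, y]) phi t + \int[mu]_(t in `]y, z]) phi t.
Proof.
move=> xy yz; have -> : `]x, z] = `]x, y] `|` `]y, z] :> set R.
  by rewrite -itv_bndbnd_setU //= bnd_simp.
rewrite Rintegral_setU //.
  by apply: unit_mass_integrable; exact: measurableU.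
apply/disj_setPS => t /=; rewrite !in_itv /= => -[/andP[_ h1] /andP[h2 _]]; lra.
Qed.

Lemma integral_full D : measurable D -> mu D = 1%E ->
  (\int[mu]_x (phi x)%:E = (\int[mu]_(x in D) phi x)%:E)%E.
Proof.
move=> mD muD; have mN : measurable (~` D) by exact: measurableC.
have N0 : mu (~` D) = 0%E.
  have E : mu (D `|` ~` D) = (mu D + mu (~` D))%E.
    by apply: measureU => //; exact/subsets_disjoint.
  move: E; rewrite setUv mu1 muD.
  move: (unit_mass_fin mN); case: (mu (~` D)) => // r _.
  by move=> /eqP; rewrite -EFinD eqe => /eqP h; congr EFin; lra.
rewrite (negligible_integral mN) //.
  by rewrite setTD setCK /Rintegral fineK // integrable_fin_num // unit_mass_integrable.
exact: unit_mass_integrable.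
Qed.

End UnitMass.

(** * A criterion for vague convergence *)

Section VagueCriterion.
Context (R : realType) (nus : nat -> {measure set R -> \bar R}).
Context (nu : {measure set R -> \bar R}) (a b : R).
Hypotheses (nus1 : forall n, nus n setT = 1%E) (nu1 : nu setT = 1%E).
Hypothesis nus_conc : forall n s t, (1 <= n)%N -> s < a -> b <= t -> nus n `]s, t] = 1%E.
Hypothesis nu_conc : forall s t, s < a -> b <= t -> nu `]s, t] = 1%E.

Definition cvg_tail (x : R) : Prop := forall eta, 0 < eta -> exists N, forall n,
  (N <= n)%N -> `|fine (nus n `]x, +oo[) - fine (nu `]x, +oo[)| <= eta.

Hypothesis dense_cvg_tail : forall u v, u < v -> exists x, [/\ u < x, x < v & cvg_tail x].

Lemma cvg_mass y z : y <= z -> cvg_tail y -> cvg_tail z ->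
  forall eta, 0 < eta -> exists N, forall n, (N <= n)%N ->
    `|fine (nus n `]y, z]) - fine (nu `]y, z])| <= eta.
Proof.
move=> yz hy hz eta eta0.
have [|N1 h1] := hy (eta / 2); first lra.
have [|N2 h2] := hz (eta / 2); first lra.
exists (maxn N1 N2) => n; rewrite geq_max => /andP[/h1 + /h2].
rewrite !(mass_split (nus1 n) yz) (mass_split nu1 yz) !ler_norml.
by move=> /andP[? ?] /andP[? ?]; apply/andP; split; lra.
Qed.

Section TestFunction.
Context (phi : R -> R) (M : R) (e : R).
Hypotheses (cphi : continuous phi) (phiM : forall x, `|phi x| <= M) (e0 : 0 < e).

Let mphi : measurable_fun setT phi.
Proof. exact: continuous_measurable_fun. Qed.

Let I (mu : {measure set R -> \bar R}) x y : R := \int[mu]_(t in `]x, y]) phi t.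

(** An error proportional to the mass of the interval adds up when intervals are joined, whatever
    their number. *)
Let close x y := forall eta, 0 < eta -> exists N, forall n, (N <= n)%N ->
  `|I (nus n) x y - I nu x y| <= 2 * e * fine (nu `]x, y]) + eta.

Let close_step x y z v : x <= y -> y <= z -> cvg_tail y -> cvg_tail z ->
  (forall t, y < t -> t <= z -> `|phi t - v| <= e) -> close x y -> close x z.
Proof.
move=> xy yz gy gz osc cxy eta eta0; have e_gt0 := e0.
have [|N1 h1] := cxy (eta / 2); first lra.
pose w : R := `|v|; have w0 : 0 <= w by exact: normr_ge0.
pose eta' := eta / (2 * (e + w + 1)).
have k0 : 0 < 2 * (e + w + 1) by lra.
have eta'0 : 0 < eta' by rewrite divr_gt0.
have [N2 h2] := cvg_mass yz gy gz eta'0.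
exists (maxn N1 N2) => n; rewrite geq_max => /andP[/h1 {}h1 /h2 {}h2].
have osc' t : `]y, z]%classic t -> `|phi t - v| <= e.
  by rewrite /= in_itv /= => /andP[]; exact: osc.
have p1 := Rintegral_near_cst (nus1 n) mphi phiM (measurable_itv _) osc'.
have p2 := Rintegral_near_cst nu1 mphi phiM (measurable_itv _) osc'.
have En : I (nus n) x z = I (nus n) x y + I (nus n) y z.
  exact: (Rintegral_split (nus1 n) mphi phiM).
have E : I nu x z = I nu x y + I nu y z by exact: (Rintegral_split nu1 mphi phiM).
rewrite -/(I _ _ _) in p1 p2.
have Em : fine (nu `]x, z]) = fine (nu `]x, y]) + fine (nu `]y, z]).
  have h3 := mass_split nu1 xy; have h4 := mass_split nu1 yz.
  by have h5 := mass_split nu1 (le_trans xy yz); lra.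
rewrite En E Em.
set A := I (nus n) x y - I nu x y in h1.
set mn := fine (nus n `]y, z]) in h2 p1.
set m := fine (nu `]y, z]) in h2 p2 *.
have -> : I (nus n) x y + I (nus n) y z - (I nu x y + I nu y z) =
   A + ((I (nus n) y z - v * mn) - (I nu y z - v * m) + v * (mn - m)) by rewrite /A; ring.
have q1 : `|v * (mn - m)| <= w * eta' by rewrite normrM; apply: ler_wpM2l.
have q2 : e * mn <= e * m + e * eta'.
  rewrite -mulrDr; apply: ler_wpM2l; first exact: ltW.
  by move: h2; rewrite ler_norml => /andP[_]; lra.
have q3 : (e + w) * eta' <= eta / 2.
  have : eta' * (2 * (e + w + 1)) = eta by rewrite divfK // gt_eqF.
  by lra.
apply: le_trans (ler_normD _ _) _.
have q4 := ler_normD ((I (nus n) y z - v * mn) - (I nu y z - v * m)) (v * (mn - m)).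
have q5 := ler_normB (I (nus n) y z - v * mn) (I nu y z - v * m).
lra.
Qed.

(** A supremum argument over the endpoints reachable from [x0] replaces a finite partition: if [b]
    were not reached, continuity of [phi] at the supremum would allow a step beyond it. *)
Lemma close_integrals eta : 0 < eta -> exists N, forall n, (N <= n)%N ->
  `|fine (\int[nus n]_x (phi x)%:E)%E - fine (\int[nu]_x (phi x)%:E)%E| <= 2 * e + eta.
Proof.
move=> eta0.
have [x0 [_ x0a g0]] := @dense_cvg_tail (a - 1) a (ltac:(lra)).
pose S := [set y | [/\ x0 <= y, cvg_tail y & close x0 y]].
have Sx0 : S x0.
  split=> // eta' e'; exists 0%N => n _.
  have I0 mu : I mu x0 x0 = 0 by rewrite /I set_itvoc0 Rintegral_set0.
  by rewrite !I0 subrr normr0 set_itvoc0 measure0 mulr0 add0r ltW.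
have [y [x0y gy cy] by_] : exists2 y, S y & b <= y.
  apply: contrapT => no.
  have ubS : ubound S b.
    by move=> y Sy; rewrite leNgt; apply/negP => /ltW bly; apply: no; exists y.
  have supS : has_sup S by split; [exists x0|exists b].
  have [d /= d0 hd] : exists2 d, 0 < d & forall t, `|sup S - t| < d -> `|phi t - phi (sup S)| <= e.
    have /cvgrPdist_le/(_ _ e0) := @cphi (sup S).
    case=> d d0 hd; exists d => // t ht; rewrite distrC; exact: hd.
  have [y [x0y gy cy] hy] := sup_adherent d0 supS.
  have ys : y <= sup S by exact: sup_upper_bound.
  have [z [z1 z2 gz]] := @dense_cvg_tail (sup S) (sup S + d) (ltac:(lra)).
  have Sz : S z.
    split=> //; first by lra.
    apply: (@close_step x0 y z (phi (sup S))) => //; first by lra.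
    by move=> t yt tz; apply: hd; rewrite ltr_norml; lra.
  by have := sup_upper_bound supS Sz; lra.
have [N hN] := cy _ eta0; exists (maxn N 1) => n; rewrite geq_max => /andP[/hN h n1].
have mD : measurable (`]x0, y]%classic : set R) by exact: measurable_itv.
rewrite (integral_full (nus1 n) mphi phiM mD (nus_conc n1 x0a by_)).
rewrite (integral_full nu1 mphi phiM mD (nu_conc x0a by_)) /=.
apply: le_trans h _; rewrite nu_conc //=; lra.
Qed.

End TestFunction.

Theorem vague_criterion : vague_cvg nus nu.
Proof.
move=> phi cphi supp_phi.
have [M phiM] : exists M, forall x, `|phi x| <= M.
  have : compact (phi @` closure [set x | phi x != 0]).
    by apply: continuous_compact => //; exact: continuous_subspaceT.
  move=> /compact_bounded[M [_ hM]]; exists (Num.max 0 (M + 1)) => x.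
  have [->|px] := eqVneq (phi x) 0; first by rewrite normr0 le_max lexx.
  rewrite le_max; apply/orP; right; apply: (hM (M + 1)); first by rewrite ltrDl.
  by exists x => //; exact: subset_closure.
have mphi : measurable_fun setT phi by exact: continuous_measurable_fun.
have fin (mu : {measure set R -> \bar R}) : mu setT = 1%E ->
    (\int[mu]_x (phi x)%:E)%E \is a fin_num.
  move=> mu1; apply: integrable_fin_num; first exact: measurableT.
  exact: (unit_mass_integrable mu1 mphi phiM).
rewrite -(fineK (fin nu nu1)); apply/fine_cvgP; split.
  by near=> n; exact: fin.
apply/cvgrPdist_le => eps eps0.
have [||N hN] := @close_integrals phi M (eps / 3) cphi phiM _ (eps / 3); try lra.
exists N => // n /= /hN; rewrite distrC => h; apply: le_trans h _; lra.
Unshelve. all: by end_near. Qed.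

End VagueCriterion.

(** * Construction of the limit measure *)

Section LimitMeasure.
Context (R : realType) (nus : nat -> {measure set R -> \bar R}) (a b : R).
Hypothesis nus1 : forall n, nus n setT = 1%E.

Let G n t : R := fine (nus n `[t, +oo[).

Hypotheses (Ga : forall n, (1 <= n)%N -> G n a = 1) (Gb : forall n, (1 <= n)%N -> G n b = 0).
Hypothesis G_quasi : forall t e eta, 0 < e -> 0 < eta ->
  exists p1, forall p, (p1 <= p)%N -> exists n1, forall n, (n1 <= n)%N ->
    G p t <= G n (t - e) + eta.

Let G_ge0 n t : 0 <= G n t.
Proof. exact: fine_ge0. Qed.

Let G_le1 n t : G n t <= 1.
Proof.
have -> : 1 = fine (nus n setT) by rewrite nus1.
exact: fine_mass_le.
Qed.

Let G_mono n s t : s <= t -> G n t <= G n s.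
Proof.
move=> st; apply: fine_mass_le => // x /=; rewrite !in_itv /= !andbT.
exact: le_trans.
Qed.

Let g_set t := [set y : R | exists N, forall n, (N <= n)%N -> G n t <= y].
(** The upper limit of [G n t] as [n] grows. *)
Let g t : R := inf (g_set t).

Let g_has_inf t : has_inf (g_set t).
Proof.
split; first by exists 1, 0%N => n _.
by exists 0 => y [N hN]; exact: le_trans (hN N (leqnn N)).
Qed.

Let g_upper t eta : 0 < eta -> exists N, forall n, (N <= n)%N -> G n t <= g t + eta.
Proof.
move=> eta0; have [y [N hN] hy] := inf_adherent eta0 (g_has_inf t).
by exists N => n /hN h; apply: le_trans h (ltW hy).
Qed.

(** By minimality of [g t], some large [p] has [G p t] close to it or above; [G_quasi] passes this
    from [p] to all large [n]. *)
Let g_lower t e eta : 0 < e -> 0 < eta ->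
  exists N, forall n, (N <= n)%N -> g t - eta <= G n (t - e).
Proof.
move=> e0 eta0; have [|p1 hp1] := @G_quasi t e (eta / 2) e0; first lra.
have [p [p1p hp]] : exists p, (p1 <= p)%N /\ g t - eta / 2 <= G p t.
  apply: contrapT => no.
  have : g t <= g t - eta / 2; last by lra.
  apply: (inf_lbound (g_has_inf t).2); exists p1 => n hn.
  by rewrite leNgt; apply/negP => h; apply: no; exists n; split=> //; exact: ltW.
have [n1 hn1] := hp1 p p1p; exists n1 => n /hn1; lra.
Qed.

Let g_ge0 t : 0 <= g t.
Proof.
apply: lb_le_inf; first exact: (g_has_inf t).1.
by move=> y [N hN]; exact: le_trans (hN N (leqnn N)).
Qed.

Let g_le1 t : g t <= 1.
Proof. by apply: (inf_lbound (g_has_inf t).2); exists 0%N => n _. Qed.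

Let g_a t : t <= a -> g t = 1.
Proof.
move=> ta; apply/eqP; rewrite eq_le g_le1 /=; apply: lb_le_inf; first exact: (g_has_inf t).1.
move=> y [N hN]; apply: le_trans (hN (maxn N 1) (leq_maxl _ _)).
by rewrite -(Ga (leq_maxr N 1)); exact: G_mono.
Qed.

Let g_b t : b <= t -> g t = 0.
Proof.
move=> bt; apply/eqP; rewrite eq_le g_ge0 andbT.
apply: (inf_lbound (g_has_inf t).2); exists 1%N => n n1.
by rewrite -(Gb n1); exact: G_mono.
Qed.

(** The right limit of the nonincreasing function [g]; it becomes the mass of the open half-line
    []x, +oo[]. *)
Let k x : R := sup [set g y | y in [set y | x < y]].

Let k_has_sup x : has_sup [set g y | y in [set y | x < y]].
Proof.
split; first by exists (g (x + 1)), (x + 1) => //=; rewrite ltrDl.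
by exists 1 => _ [y _ <-].
Qed.

Let k_ge x y : x < y -> g y <= k x.
Proof. by move=> xy; apply: (sup_upper_bound (k_has_sup x)); exists y. Qed.

Let k_adh x e : 0 < e -> exists2 y, x < y & k x - e < g y.
Proof. by move=> e0; have [_ [y xy <-] h] := sup_adherent e0 (k_has_sup x); exists y. Qed.

Let k_le x c : (forall y, x < y -> g y <= c) -> k x <= c.
Proof. by move=> h; apply: ge_sup (k_has_sup x).1 _ => _ [y xy <-]; exact: h. Qed.

Let Fc x : R := 1 - k x.

Let Fc_a s : s < a -> Fc s = 0.
Proof.
move=> sa; rewrite /Fc; suff -> : k s = 1 by rewrite subrr.
by apply/eqP; rewrite eq_le k_le //= -(g_a (lexx a)); exact: k_ge.
Qed.

Let Fc_b t : b <= t -> Fc t = 1.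
Proof.
move=> bt; rewrite /Fc; suff -> : k t = 0 by rewrite subr0.
apply/eqP; rewrite eq_le k_le /= => [|y ty].
  by apply: le_trans (g_ge0 (t + 1)) (k_ge _); rewrite ltrDl.
by rewrite g_b //; apply: le_trans bt (ltW ty).
Qed.

Let Fc_probability : exists nu : probability R R,
  forall s t, s <= t -> nu `]s, t] = (Fc t - Fc s)%:E.
Proof.
apply: (@stieltjes_probability R Fc a b).
- move=> x y xy; rewrite lerD2l lerN2; apply: k_le => z yz.
  by apply: k_ge; exact: le_lt_trans yz.
- move=> x e e0; have [y0 xy0 hy0] := k_adh x e0; exists y0 => // y xy yy0.
  by have := k_ge yy0; rewrite /Fc; lra.
- exact: Fc_a.
- exact: Fc_b.
Qed.

(* Distinct jumps of [g] contain distinct rationals. *)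
Let jumps_countable : countable [set x | k x < g x].
Proof.
have /(_ _)/cid-/all_sig[q hq] (x : R) : exists q : rat, k x < g x -> k x < ratr q < g x.
  have [kg|kg] := ltP (k x) (g x); last by exists 0.
  by have [q hq] := rat_in_itvoo kg; exists q => _; move: hq; rewrite in_itv.
apply/countable_injP; exists (pickle \o q) => x y; rewrite !inE /= => kx ky.
move=> /(pcan_inj pickleK) qxy; have hx := hq x kx; have hy := hq y ky.
rewrite qxy in hx; have [xy|yx|//] := ltgtP x y.
  by have := k_ge xy; lra.
by have := k_ge yx; lra.
Qed.

Theorem limit_measure : exists nu : probability R R, vague_cvg nus nu.
Proof.
have [nu hnu] := Fc_probability; exists nu.
have nuT : nu setT = 1%E by exact: probability_setT.
have ab : a < b.
  rewrite ltNge; apply/negP => ba; have := G_mono 1 ba; rewrite Ga // Gb //; lra.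
have nuc s t : s < a -> b <= t -> nu `]s, t] = 1%E.
  move=> sa bt; have st : s <= t by lra.
  by rewrite hnu // (Fc_a sa) (Fc_b bt) subr0.
have nutail x : fine (nu `]x, +oo[) = k x.
  (* []s, t]] already carries the full mass, so nothing lies beyond [t]. *)
  pose t := Num.max x b; pose s := Num.min x (a - 1).
  have xt : x <= t by rewrite le_max lexx.
  have bt : b <= t by rewrite le_max lexx orbT.
  have sa : s < a by rewrite gt_min; apply/orP; right; lra.
  have st : s <= t by lra.
  have h1 : fine (nu `]s, +oo[) = fine (nu `]s, t]) + fine (nu `]t, +oo[).
    exact: (mass_split nuT st).
  have h2 : fine (nu `]x, +oo[) = fine (nu `]x, t]) + fine (nu `]t, +oo[).
    exact: (mass_split nuT xt).
  have h3 : fine (nu `]s, +oo[) <= fine (nu setT) by exact: (fine_mass_le nuT).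
  have h4 : 0 <= fine (nu `]t, +oo[) by exact: fine_ge0.
  move: h1 h2 h3 h4; rewrite nuT (nuc _ _ sa bt) (hnu _ _ xt) (Fc_b bt) /Fc /=.
  lra.
apply: (@vague_criterion R nus nu a b nus1 nuT) => //.
- move=> n s t n1 sa bt; have st : s <= t by lra.
  have h1 := mass_split (nus1 n) st.
  have h2 : 1 <= fine (nus n `]s, +oo[).
    rewrite -(Ga n1); apply: fine_mass_le => // x /=; rewrite !in_itv /= !andbT; lra.
  have h3 : fine (nus n `]t, +oo[) <= 0.
    rewrite -(Gb n1); apply: fine_mass_le => // x /=; rewrite !in_itv /= !andbT; lra.
  have h4 : 0 <= fine (nus n `]t, +oo[) by exact: fine_ge0.
  have h5 : fine (nus n `]s, +oo[) <= 1.
    have -> : 1 = fine (nus n setT) by rewrite nus1.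
    exact: fine_mass_le.
  rewrite -(fineK (unit_mass_fin (nus1 n) (measurable_itv _))); congr EFin; lra.
move=> u v uv.
(* An interval of positive Lebesgue measure is uncountable, so it contains a point without jump. *)
have [x [ux xv kg]] : exists x, [/\ u < x, x < v & g x <= k x].
  apply: contrapT => no.
  have sub : `]u, v[ `<=` [set x | k x < g x].
    move=> x /=; rewrite in_itv /= => /andP[ux xv]; rewrite ltNge; apply/negP => h.
    by apply: no; exists x.
  have /countable_lebesgue_measure0 : countable (`]u, v[%classic : set R).
    exact: sub_countable (subset_card_le sub) jumps_countable.
  rewrite lebesgue_measure_itv /= lte_fin uv -EFinD => /eqP; rewrite eqe subr_eq0.
  by move=> /eqP h; move: uv; rewrite h ltxx.
exists x; split=> // eta eta0; rewrite nutail.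
have [N1 h1] := g_upper x eta0.
have eta2 : 0 < eta / 2 by lra.
(* [g y] gives [k x] up to [eta / 2]; [g_lower] at [y] bounds the tails at the midpoint of [x] and
   [y], still to the right of [x]. *)
have [y xy hy] := k_adh x eta2.
have e0 : 0 < (y - x) / 2 by lra.
have [N2 h2] := g_lower y e0 eta2.
exists (maxn N1 N2) => n; rewrite geq_max => /andP[/h1 {}h1 /h2 {}h2].
have h3 : fine (nus n `]x, +oo[) <= G n x.
  by apply: fine_mass_le => // z /=; rewrite !in_itv /= !andbT => /ltW.
have h4 : G n (y - (y - x) / 2) <= fine (nus n `]x, +oo[).
  apply: fine_mass_le => // z /=; rewrite !in_itv /= !andbT; lra.
by rewrite ler_norml; apply/andP; split; lra.
Qed.

End LimitMeasure.

(** * Rescaled measures and supports *)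

Lemma has_dim_zero (K : fieldType) (A : comAlgType K) (W : A -> Prop) d :
  (forall a, W a -> a = 0) -> has_dim W d -> d = 0%N.
Proof.
move=> W0 /free_in_dim[[|x s] [<- Ws fs]] //.
have x0 : x = 0 by apply/W0/Ws/mem_head.
have := fs (fun i => if i == ord0 then 1 else 0).
rewrite big_ord_recl /= x0 scaler0 add0r big1 => [|i _]; last by rewrite scale0r.
by move=> /(_ erefl ord0) /= /eqP; rewrite oner_eq0.
Qed.

Lemma limn_esup_bound (R : realType) (u : nat -> \bar R) : (limn_esup u < +oo)%E ->
  exists (M : R) N, forall n, (N <= n)%N -> (u n <= M%:E)%E.
Proof.
rewrite limn_esup_lim => h.
have [N hN] : exists N, (esups u N < +oo)%E.
  apply: contrapT => no; move: h; rewrite (_ : esups u = cst +oo%E).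
    by rewrite lim_cst // ltxx.
  apply/funext => n; apply/eqP; rewrite -leye_eq leNgt; apply/negP => hn.
  by apply: no; exists n.
(* The maximum with [0] covers a supremum equal to [-oo]. *)
exists (fine (maxe 0%E (esups u N))), N => n nN.
rewrite fineK; last by rewrite ge0_fin_numE ?le_max ?lexx // gt_max ltry hN.
rewrite le_max; apply/orP; right.
by apply: ereal_sup_ubound; exists n.
Qed.

Lemma filtration_upper (R : realType) (K : fieldType) (A : comAlgType K)
    (B : nat -> A -> Prop) (F : nat -> R -> A -> Prop) :
  (forall n, (1 <= n)%N -> good_filtration (B n) (F n)) ->
  (limn_esup (fun n : nat =>
     ereal_sup [set (flambda (F n) a * ((n%:R)^-1)%R%:E)%E
               | a in [set a | B n a /\ a <> 0%R]]) < +oo)%E ->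
  exists (M : R) N, forall n s a, (1 <= n)%N -> (N <= n)%N -> n%:R * M < s ->
    F n s a -> a = 0.
Proof.
move=> filtF /limn_esup_bound[M [N hN]]; exists M, N => n s a n1 nN Ms Fa.
apply: contrapT => a0; move: Ms; rewrite ltNge => /negP[].
have n0 : 0 < n%:R :> R by rewrite ltr0n.
rewrite mulrC -ler_pdivrMr // -lee_fin; apply: le_trans (hN n nN).
apply: le_trans (ereal_sup_ubound _); last by exists a => //; split=> //; apply: (FB filtF) Fa.
rewrite EFinM; apply: lee_wpmul2r; first by rewrite lee_fin invr_ge0 ltW.
by apply: ereal_sup_ubound; exists s.
Qed.

Section Tscale.
Context (R : realType) (mu : probability R R) (n : nat).
Hypothesis n1 : (1 <= n)%N.

Lemma Tscale_setT (e : R) : Tscale e mu setT = 1%E.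
Proof. by rewrite /Tscale /pushforward preimage_setT; exact: probability_setT. Qed.

Lemma Tscale_tail (t : R) : Tscale (n%:R)^-1 mu `[t, +oo[ = mu `[n%:R * t, +oo[.
Proof.
rewrite /Tscale /pushforward; congr (mu _); apply/seteqP; split=> x /=;
  rewrite !in_itv /= !andbT ler_pdivlMr ?ltr0n // mulrC //.
Qed.

End Tscale.

Lemma msupport_sub (R : realType) (nu : {measure set R -> \bar R}) (a b : R) :
  nu setT = 1%E -> nu `[a, +oo[ = 1%E -> nu `[b, +oo[ = 0%E ->
  msupport nu `<=` `[a, b].
Proof.
move=> nu1 nua nub x hx /=; rewrite in_itv /=; apply/andP; split; rewrite leNgt;
  apply/negP => xab.
  have : (0 < nu `]-oo, a[)%E by apply: hx => //=; rewrite in_itv.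
  suff -> : nu `]-oo, a[ = 0%E by rewrite ltxx.
  have : nu (`]-oo, a[ `|` `[a, +oo[) = (nu `]-oo, a[ + nu `[a, +oo[)%E.
    apply: measureU => //; apply/seteqP; split=> // y /=.
    by rewrite !in_itv /= andbT => -[h1 h2]; have := lt_le_trans h1 h2; rewrite ltxx.
  rewrite -itv_bndbnd_setU //= set_itvE nu1 nua.
  move: (unit_mass_fin nu1 (measurable_itv _ : measurable `]-oo, a[));
    case: (nu `]-oo, a[) => // r _.
  by move=> /eqP; rewrite -EFinD eqe => /eqP h; congr EFin; apply: (addIr 1); rewrite add0r.
have : (0 < nu `]b, +oo[)%E by apply: hx => //=; rewrite in_itv /= andbT.
rewrite ltNge => /negP; apply; rewrite -nub; apply: le_measure; rewrite ?inE //.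
by move=> y /=; rewrite !in_itv /= !andbT => /ltW.
Qed.

(** Handles the finitely many degrees below the threshold from which the linear bounds hold. *)
Lemma finite_lower_bound (R : realType) (P : nat -> R -> Prop) :
  (forall n s t, s <= t -> P n t -> P n s) -> (forall n, exists s, P n s) ->
  forall N, exists s, forall n, (n < N)%N -> P n s.
Proof.
move=> Pm Pe; elim=> [|N [s hs]]; first by exists 0.
have [t ht] := Pe N; exists (Num.min s t) => n; rewrite ltnS leq_eqVlt.
move=> /predU1P[->|/hs h]; first by apply: Pm ht; rewrite ge_min lexx orbT.
by apply: Pm h; rewrite ge_min lexx.
Qed.

Theorem mainTheorem20 (R : realType) (K : fieldType) (A : comAlgType K)
  (f : nat -> R)
  (B : nat -> A -> Prop) (F : nat -> R -> A -> Prop)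
  (mu : nat -> probability R R) :
  (* f : Z_{>=0} -> R_{>=0} increasing, with sum_a f(2^a)/2^a < +oo *)
  (forall n, 0 <= f n) ->
  (forall n m, (n <= m)%N -> f n <= f m) ->
  cvgn (series (fun a : nat => f (2 ^ a)%N / (2 ^ a)%:R)) ->
  (* B = ⊕ B_n integral graded K-algebra of finite type generated by B_1 *)
  graded_alg B -> integral_alg A -> finite_type_alg A -> generated_by (B 1%N) ->
  (* (i) Krull dimension > 0 *)
  krull_dim_pos A ->
  (* (ii) filtrations and f-pseudo-filtered structure *)
  (forall n, (1 <= n)%N -> good_filtration (B n) (F n)) ->
  (exists N : nat, forall (n m : nat), (N <= n)%N -> (N <= m)%N ->
     forall (s t : R) (a b : A), F n s a -> F m t b ->
       F (n + m)%N (s + t - f n - f m) (a * b)) ->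
  (* (iii) limsup_n sup_{0 <> a in B_n} lambda(a)/n < +oo *)
  (limn_esup (fun n : nat =>
     ereal_sup [set (flambda (F n) a * ((n%:R)^-1)%R%:E)%E
               | a in [set a | B n a /\ a <> 0%R]]) < +oo)%E ->
  (* mu n = nu_{B_n} *)
  (forall n, (1 <= n)%N -> is_filtration_measure (B n) (F n) (mu n)) ->
  (* conclusion, with nu_n = T_{1/n} nu_{B_n} *)
  (exists a b : R, forall n, (1 <= n)%N ->
      msupport (Tscale (n%:R)^-1 (mu n)) `<=` `[a, b]) /\
  (exists nu : probability R R,
      vague_cvg (fun n => Tscale (n%:R)^-1 (mu n)) nu).
Proof.
move=> f0 fm fc gB intA ftA genA krA filtF [N0 mulF] supF muF.
have [d [C [x0 [Bx0 x0n dimB mulB powB]]]] :=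
  graded_dimensions gB intA ftA genA krA.
have [c [nl [c0 lowF]]] := filtration_lower f0 fm fc filtF mulF dimB mulB.
have cmpF := dim_compare f0 fm fc filtF mulF dimB mulB powB.
have [M [nM upF]] := filtration_upper filtF supF.
have /choice[D hD] n : exists D, (1 <= n)%N -> has_dim (B n) D.
  by have [D hD] := max_free_in (dimB n); exists D.
have /choice[h' hh'] (ns : nat * R) :
    exists h, (1 <= ns.1)%N -> has_dim (F ns.1 ns.2) h.
  have [n1|n0] := leqP 1 ns.1; last by exists 0%N.
  have [|h hh] := @max_free_in _ _ (F ns.1 ns.2) (C * ns.1.+1 ^ d).
    by move=> s hs; apply: dimB => x /hs; exact: (FB filtF n1).
  by exists h.
pose h n s := h' (n, s).
have hh n s : (1 <= n)%N -> has_dim (F n s) (h n s) by move=> n1; exact: (hh' (n, s) n1).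
have Dgt0 n (n1 : (1 <= n)%N) := D_gt0 gB Bx0 x0n intA hD n1.
have tailE n t : (1 <= n)%N -> Tscale (n%:R)^-1 (mu n) `[t, +oo[ =
    ((h n (n%:R * t))%:R / (D n)%:R)%:E.
  by move=> n1; rewrite Tscale_tail //; apply: muF => //; [exact: hD|exact: hh].
have [a ha] : exists a, forall n, (1 <= n)%N -> h n (n%:R * a) = D n.
  have [||s hs] := @finite_lower_bound R
      (fun n s => (1 <= n)%N -> forall b, B n b -> F n (n%:R * s) b) _ _ nl.
  - move=> n s t st ht n1 b /(ht n1); apply: (Fle filtF n1).
    by rewrite ler_wpM2l.
  - move=> n; have [n1|n0] := leqP 1 n; last by exists 0.
    have [s hs] := filtration_full filtF dimB n1.
    by exists (s / n%:R) => _ b /hs; rewrite mulrC divfK // pnatr_eq0 -lt0n.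
  exists (Num.min s (- c)) => n n1.
  apply/eqP; rewrite eqn_leq (h_le_D filtF hD hh) //=.
  apply: (has_dim_free_in (hh _ _ n1)); apply: free_inS (free_in_dim (hD _ n1)) => b Bb.
  have [nn|nn] := ltnP n nl.
    by apply: (Fle filtF n1) (hs n nn n1 b Bb); rewrite ler_wpM2l // ge_min lexx.
  apply: (Fle filtF n1) (lowF n b nn Bb).
  by rewrite mulrC ler_wpM2r // ge_min lexx orbT.
(* The upper end uses the same lemma as [a], with levels negated to reverse the monotonicity. *)
have [b hb] : exists b, forall n, (1 <= n)%N -> h n (n%:R * b) = 0%N.
  have [||s hs] := @finite_lower_bound R
      (fun n s => (1 <= n)%N -> forall x, F n (n%:R * - s) x -> x = 0) _ _ nM.
  - move=> n s t st ht n1 x hx; apply: (ht n1); apply: (Fle filtF n1) hx.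
    by rewrite ler_wpM2l // lerN2.
  - move=> n; have [n1|n0] := leqP 1 n; last by exists 0.
    have [s hs] := filtration_trivial filtF dimB n1.
    exists (- (s / n%:R)) => _ x.
    by rewrite opprK mulrC divfK ?pnatr_eq0 -?lt0n //; exact: hs.
  exists (Num.max (- s) (M + 1)) => n n1.
  apply: has_dim_zero (hh _ _ n1) => x hx.
  have [nn|nn] := ltnP n nM.
    apply: (hs n nn n1); apply: (Fle filtF n1) hx.
    by rewrite ler_wpM2l // le_max lexx.
  apply: (upF n (n%:R * (M + 1)) x n1 nn).
    by rewrite ltr_pM2l ?ltr0n // ltrDl.
  by apply: (Fle filtF n1) hx; rewrite ler_wpM2l // le_max lexx orbT.
have tail1 n : (1 <= n)%N -> Tscale (n%:R)^-1 (mu n) `[a, +oo[ = 1%E.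
  by move=> n1; rewrite tailE // ha // divff // pnatr_eq0 -lt0n Dgt0.
have tail0 n : (1 <= n)%N -> Tscale (n%:R)^-1 (mu n) `[b, +oo[ = 0%E.
  by move=> n1; rewrite tailE // hb // mul0r.
split.
  exists a, b => n n1; apply: msupport_sub; [exact: Tscale_setT|exact: tail1|exact: tail0].
apply: (@limit_measure R (fun n => Tscale (n%:R)^-1 (mu n)) a b).
- by move=> n; exact: Tscale_setT.
- by move=> n n1; exact: (congr1 (@fine R) (tail1 n n1)).
- by move=> n n1; exact: (congr1 (@fine R) (tail0 n n1)).
move=> t e eta e0 eta0.
have [p1 hp1] := ratio_compare gB Bx0 x0n intA filtF dimB lowF cmpF hD hh t e0 eta0.
exists (maxn p1 1) => p; rewrite geq_max => /andP[/hp1[n1 hn1] pp].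
exists (maxn n1 1) => n; rewrite geq_max => /andP[/hn1 hn nn].
rewrite (_ : fine _ = (h p (p%:R * t))%:R / (D p)%:R); last first.
  exact: (congr1 (@fine R) (tailE p t pp)).
rewrite (_ : fine _ = (h n (n%:R * (t - e)))%:R / (D n)%:R) //.
exact: (congr1 (@fine R) (tailE n (t - e) nn)).
Qed.
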